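(* Let $Q=\mathbb{S}^1\times M$ with coordinates $(\theta,x)$, with $\mathbb{S}^1$ acting on $Q$ by $(\theta,x)\mapsto(\theta+\alpha,x)$. Let $\mathscr{L}_F=(TQ,X_L^F,S,\Delta)$ be a simple hybrid forced Lagrangian system such that: - $L=L(\dot\theta,x,\dot x)$ is a hyperregular, $\mathbb{S}^1$-regular Lagrangian for which $\theta$ is a cyclic coordinate; - the force $F=F_\theta\,d\theta+F_x\,dx$ satisfies $F_\theta=0$ and $F_x$ is independent of $\theta$; - the $\mathbb{S}^1$-action is a hybrid action on $\mathscr{L}_F$; - the momentum map $J_L=\frac{\partial L}{\partial\dot\theta}$ is preserved in the collisions with the switching surface (elastic case), i.e. $J_L\circ\Delta=J_L|_S$. Let $\mu\in\mathbb{R}$ be a hybrid regular value of $J_L$, and let $\mathscr{L}_F^\mu=(T(Q/\mathbb{S}^1),X_{R_F}^\mu,S_\mu,\Delta_\mu)$ be the reduced simple hybrid forced Routhian system. Then: (a) Any solution of $\mathscr{L}_F=(TQ,X_L^F,S,\Delta)$ with momentum $\mu$ projects onto a solution of $\mathscr{L}_F^\mu=(T(Q/\mathbb{S}^1),X_{R_F}^\mu,S_\mu,\Delta_\mu)$. (b) Any solution of $\mathscr{L}_F^\mu=(T(Q/\mathbb{S}^1),X_{R_F}^\mu,S_\mu,\Delta_\mu)$ is the projection of a solution of $\mathscr{L}_F=(TQ,X_L^F,S,\Delta)$ with momentum $\mu$.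
   Context: **Forced Lagrangian dynamics.** For a manifold $N$ with coordinates $(q^i)$, a regular Lagrangian $L:TN\to\mathbb{R}$ and an external force, i.e. a smooth map $F:TN\to T^*N$ over the identity of $N$, locally $F=F_i(q,\dot q)\,dq^i$, the forced Euler–Lagrange equations are $\frac{d}{dt}\left(\frac{\partial L}{\partial \dot q^i}\right)-\frac{\partial L}{\partial q^i}=F_i(q,\dot q)$; they define a second-order vector field $X_L^F$ on $TN$. $L$ is hyperregular if the Legendre transformation $(q,\dot q)\mapsto(q,\partial L/\partial\dot q)$ is a diffeomorphism $TN\to T^*N$. **Simple hybrid systems and solutions.** A simple hybrid system is a tuple $(D,X,S,\Delta)$ where $D$ is a smooth manifold, $X$ a smooth vector field on $D$, $S$ (the switching surface) an embedded submanifold of $D$ of codimension $1$, and $\Delta:S\to D$ (the impact map) a smooth embedding. It is a simple hybrid forced Lagrangian system if $D=TQ$ and $X=X_L^F$. Standing assumption: the closure of $\Delta(S)$ is disjoint from $S$, and the set of impact times is closed and discrete. A solution (hybrid flow) of $(D,X,S,\Delta)$ is a tuple $(\Lambda,\mathcal{J},\mathscr{C})$ where $\Lambda=\{0,1,2,\dots\}\subseteq\mathbb{N}$ is a finite or infinite indexing set; $\mathcal{J}=\{I_i\}_{i\in\Lambda}$ is a set of intervals with $I_i=[\tau_i,\tau_{i+1}]$ if $i,i+1\in\Lambda$ and, if $|\Lambda|=N$ is finite, $I_{N-1}=[\tau_{N-1},\tau_N]$, $[\tau_{N-1},\tau_N)$ or $[\tau_{N-1},\infty)$, with $\tau_i\le\tau_{i+1}$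 real; and $\mathscr{C}=\{c_i\}_{i\in\Lambda}$ is a collection of integral curves $c_i:I_i\to D$ of $X$ such that for each $i,i+1\in\Lambda$ one has $c_i(\tau_{i+1})\in S$ and $\Delta(c_i(\tau_{i+1}))=c_{i+1}(\tau_{i+1})$. A solution of $\mathscr{L}_F$ has momentum $\mu$ if $J_L(c_i(t))=\mu$ for all $i\in\Lambda$ and $t\in I_i$. **Hybrid action.** Let $\psi^{TQ}$ denote the tangent lift of the action $\psi$ of $G=\mathbb{S}^1$ on $Q$, $\psi^{TQ}_g=T\psi_g$. The action is a hybrid action on $\mathscr{L}_F$ if $L\circ\psi^{TQ}_g=L$ for all $g$, $\psi^{TQ}$ restricts to an action of $G$ on $S$, and $\Delta\circ\psi^{TQ}_g|_S=\psi^{TQ}_g\circ\Delta$ for all $g$. **$G$-regularity and regular values.** $L$ is $G$-regular if for each $v_q\in TQ$ the map $\mathfrak{g}\to\mathfrak{g}^*$, $\xi\mapsto J_L(v_q+\xi_Q(q))$, is a diffeomorphism, where $\xi_Q$ is the infinitesimal generator of $\xi\in\mathfrak{g}$. Here $\mathfrak{g}=\mathbb{R}$, $J_L=\partial L/\partial\dot\theta$, and this means that for each $(x,\dot x)$ the map $\dot\theta\mapsto\frac{\partial L}{\partial\dot\theta}(\dot\theta,x,\dot x)$ is a diffeomorphism of $\mathbb{R}$; hence $\frac{\partial L}{\partial\dot\theta}=\mu$ can be solved as $\dot\theta=\dot\theta(x,\dot x,\mu)$. A hybrid regular value of $J_L$ is a $\mu$ which is a regular value of both $J_L$ and $J_L|_S$.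 **Reduced system.** Identify $Q/\mathbb{S}^1=M$ and $J_L^{-1}(\mu)/\mathbb{S}^1$ with $TM=T(Q/\mathbb{S}^1)$ via the projection $\pi_\mu:J_L^{-1}(\mu)\to TM$, $(\theta,x,\dot\theta,\dot x)\mapsto(x,\dot x)$. A solution of $\mathscr{L}_F$ with momentum $\mu$ is projected by composing each $c_i$ with $\pi_\mu$ (keeping $\Lambda$ and $\mathcal{J}$). The Routhian is $$R^\mu(x,\dot x)=\left[L(\dot\theta,x,\dot x)-\mu\dot\theta\right]\Big|_{\dot\theta=\dot\theta(x,\dot x,\mu)},$$ and the reduced force is $F_\mu=F_x\big|_{\dot\theta=\dot\theta(x,\dot x,\mu)}\,dx$. $X_{R_F}^\mu$ is the vector field on $TM$ defined by the forced Euler–Lagrange equations of the Lagrangian $R^\mu$ with force $F_\mu$ on $M$. The reduced switching surface is $S_\mu=\pi_\mu(S\cap J_L^{-1}(\mu))$, and $\Delta_\mu:S_\mu\to TM$ is the map induced by $\Delta$, i.e. $\Delta_\mu\circ\pi_\mu=\pi_\mu\circ\Delta$ on $S\cap J_L^{-1}(\mu)$. *)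

(* Defs.v *)
From mathcomp Require Import all_boot all_order all_algebra.
From mathcomp Require Import all_classical all_reals all_analysis.
From mathcomp Require Import ring.

Set Implicit Arguments.
Unset Strict Implicit.
Unset Printing Implicit Defensive.

Import Order.TTheory GRing.Theory Num.Theory numFieldNormedType.Exports.
Local Open Scope classical_set_scope.
Local Open Scope ring_scope.

(* Only meant for finite-dimensional V, where it is the usual C^k. *)
Fixpoint Ck_on (R : realType) (V W : normedModType R) (k : nat)
    (U : set V) (f : V -> W) : Prop :=
  match k with
  | 0%N => forall x, U x -> {for x, continuous f}
  | k'.+1 => (forall x, U x -> differentiable f x) /\
             (forall v, Ck_on k' U (fun x => 'D_v f x))
  end.

Definition smooth_on (R : realType) (V W : normedModType R)
    (U : set V) (f : V -> W) : Prop :=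
  forall k, Ck_on k U f.

(* A set with an atlas of charts valued in E and a preferred chart [at_ p]
   around each point p.  [param i] is the inverse of the chart [coord i]; outside
   [coord i @` dom i] (resp. [dom i]) the values of [param i] (resp. [coord i])
   are irrelevant.  The topology is the one determined by the atlas.  The
   axioms are in [smooth_manifold]. *)
Record mfd (R : realType) (E : normedModType R) := Mfd {
  pt :> Type;
  idx : Type;
  dom : idx -> set pt;
  coord : idx -> pt -> E;
  param : idx -> E -> pt;
  at_ : pt -> idx }.

Section Manifolds.
Context {R : realType}.

Definition mopen (E : normedModType R) (N : mfd E) (U : set N) : Prop :=
  forall i : idx N, open (coord i @` (U `&` dom i)).

Definition mclosure (E : normedModType R) (N : mfd E) (A : set N) : set N :=
  [set p | forall U : set N, mopen U -> U p -> U `&` A !=set0].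

Record smooth_manifold (E : normedModType R) (N : mfd E) : Prop := {
  dom_at : forall p : N, dom (at_ p) p;
  coordK : forall (i : idx N) (p : N), dom i p -> param i (coord i p) = p;
  overlap_open : forall i j : idx N, open (coord i @` (dom i `&` dom j));
  transition_smooth : forall i j : idx N,
    smooth_on (coord i @` (dom i `&` dom j)) (coord j \o param i);
  hausdorff_mfd : forall p q : N, p <> q -> exists U V : set N,
    [/\ mopen U, mopen V, U p, V q & U `&` V = set0];
  second_countable_mfd : exists B : nat -> set N,
    (forall k, mopen (B k)) /\
    (forall (U : set N) (p : N), mopen U -> U p ->
       exists k, B k p /\ B k `<=` U) }.

Definition line : mfd R :=
  @Mfd R R R unit (fun _ => setT) (fun _ => id) (fun _ => id) (fun _ => tt).

Definition smooth_map (E F : normedModType R) (N : mfd E) (P : mfd F)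
    (f : N -> P) : Prop :=
  forall p : N, exists U : set N,
    [/\ mopen U, U p, U `<=` dom (at_ p), f @` U `<=` dom (at_ (f p)) &
        smooth_on (coord (at_ p) @` U) (coord (at_ (f p)) \o f \o param (at_ p))].

Definition diffeomorphism (E F : normedModType R) (N : mfd E) (P : mfd F)
    (f : N -> P) : Prop :=
  smooth_map f /\
  exists g : P -> N, [/\ smooth_map g, cancel f g & cancel g f].

(* Tangent vectors at p are represented throughout by their components in the
   preferred chart [at_ p]; these are the components in any chart i at p. *)
Definition vcomp (E : normedModType R) (N : mfd E) (i : idx N) (p : N)
    (v : E) : E :=
  'd (coord i \o param (at_ p)) (coord (at_ p) p) v.

(* The atlas consists of the induced charts (q, qdot). *)
Definition TB (E : normedModType R) (N : mfd E) : mfd (E * E)%type :=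
  @Mfd R (E * E)%type (N * E)%type (idx N)
    (fun i => [set w | dom i w.1])
    (fun i w => (coord i w.1, vcomp i w.1 w.2))
    (fun i y => let p := param i y.1 in
                (p, 'd (coord (at_ p) \o param i) (y.1) (y.2)))
    (fun w => at_ w.1).

Definition tangent_at (E F : normedModType R) (N : mfd E) (P : mfd F)
    (f : N -> P) (p : N) (v : E) : F :=
  'd (coord (at_ (f p)) \o f \o param (at_ p)) (coord (at_ p) p) v.

Definition tangent_map (E F : normedModType R) (N : mfd E) (P : mfd F)
    (f : N -> P) : TB N -> TB P :=
  fun w => (f w.1, tangent_at f w.1 w.2).

Definition smooth_embedding (E F : normedModType R) (N : mfd E) (P : mfd F)
    (f : N -> P) : Prop :=
  [/\ smooth_map f,
      forall p v, tangent_at f p v = 0 -> v = 0,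
      injective f &
      (* the inverse of f is continuous on the image *)
      forall U : set N, mopen U ->
        exists V : set P, mopen V /\ f @` U = V `&` range f].

Definition regular_value (E F : normedModType R) (N : mfd E) (P : mfd F)
    (f : N -> P) (y : P) : Prop :=
  forall p, f p = y -> forall b, exists v, tangent_at f p v = b.

Definition smooth_vector_field (E : normedModType R) (N : mfd E)
    (X : N -> E) : Prop :=
  smooth_map ((fun p => (p, X p)) : N -> TB N).

(* At an end point of I the derivative is one-sided; on a one-point
   interval there is no condition. *)
Definition integral_curve (E : normedModType R) (N : mfd E) (X : N -> E)
    (I : set R) (c : R -> N) : Prop :=
  forall t, I t ->
    (forall U : set N, mopen U -> U (c t) ->
       \forall s \near within I (nbhs t), U (c s)) /\
    (fun s => (s - t)^-1 *: (coord (at_ (c t)) (c s) - coord (at_ (c t)) (c t)))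
      @ within (I `\ t) (nbhs t) --> X (c t).

Definition ebase (n : nat) (k : 'I_n) : 'rV[R]_n := delta_mx 0 k.

(* Covectors at p are represented by their components p_k in the preferred
   chart; these are the components in any chart i at p. *)
Definition covcomp (n : nat) (N : mfd 'rV[R]_n) (i : idx N) (p : N)
    (a : 'rV[R]_n) : 'rV[R]_n :=
  \row_k \sum_j a 0 j *
    ('d (coord (at_ p) \o param i) (coord i p) (ebase k) : 'rV[R]_n) 0 j.

Definition CTB (n : nat) (N : mfd 'rV[R]_n) :
    mfd ('rV[R]_n * 'rV[R]_n)%type :=
  @Mfd R ('rV[R]_n * 'rV[R]_n)%type (N * 'rV[R]_n)%type (idx N)
    (fun i => [set w | dom i w.1])
    (fun i w => (coord i w.1, covcomp i w.1 w.2))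
    (fun i y => let p := param i y.1 in
                (p, \row_k \sum_j y.2 0 j * vcomp i p (ebase k) 0 j))
    (fun w => at_ w.1).

Definition prodM (m n : nat) (N : mfd 'rV[R]_m) (P : mfd 'rV[R]_n) :
    mfd 'rV[R]_(m + n) :=
  @Mfd R 'rV[R]_(m + n) (N * P)%type (idx N * idx P)%type
    (fun i => [set w | dom i.1 w.1 /\ dom i.2 w.2])
    (fun i w => row_mx (coord i.1 w.1) (coord i.2 w.2))
    (fun i y => (param i.1 (lsubmx y), param i.2 (rsubmx y)))
    (fun w => (at_ w.1, at_ w.2)).

End Manifolds.

Section Circle.
Context {R : realType}.

Definition circle_pt := {p : R * R | p.1 ^+ 2 + p.2 ^+ 2 == 1}.

Lemma cexp_subproof (t : R) :
  (cos t, sin t).1 ^+ 2 + (cos t, sin t).2 ^+ 2 == 1.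
Proof. by rewrite /= cos2Dsin2. Qed.

Definition cexp (t : R) : circle_pt := exist _ (cos t, sin t) (cexp_subproof t).

Definition cmul_pair (p q : R * R) : R * R :=
  (p.1 * q.1 - p.2 * q.2, p.1 * q.2 + p.2 * q.1).

Lemma cmul_subproof (g z : circle_pt) :
  (cmul_pair (sval g) (sval z)).1 ^+ 2 + (cmul_pair (sval g) (sval z)).2 ^+ 2
    == 1.
Proof.
case: g z => [[a b] /= /eqP gE] [[c d] /= /eqP zE]; apply/eqP.
transitivity ((a ^+ 2 + b ^+ 2) * (c ^+ 2 + d ^+ 2)); first by ring.
by rewrite gE zE mulr1.
Qed.

Definition cmul (g z : circle_pt) : circle_pt :=
  exist _ (cmul_pair (sval g) (sval z)) (cmul_subproof g z).

(* The charts are the angles theta in ]a - pi, a + pi[, for a in R; the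
   preferred chart at z is centred at an angle of z.  Changes of charts are
   locally translations, so theta-components of vectors and covectors do not
   depend on the chart. *)
Definition circle : mfd 'rV[R]_1 :=
  @Mfd R 'rV[R]_1 circle_pt R
    (fun a => cexp @` `]a - pi, a + pi[%classic)
    (fun a z => const_mx (xget 0 [set t | a - pi < t < a + pi /\ cexp t = z]))
    (fun _ y => cexp (y 0 0))
    (fun z => xget 0 [set t | cexp t = z]).

End Circle.

Arguments circle R : clear implicits.

Section ForcedLagrangian.
Context {R : realType} {n : nat} (N : mfd 'rV[R]_n).

Definition fibre_derivative (L : TB N -> R) (w : TB N) : 'rV[R]_n :=
  \row_k 'D_(ebase k) (fun v => L (w.1, v)) w.2.

Definition legendre (L : TB N -> R) : TB N -> CTB N :=
  fun w => (w.1, fibre_derivative L w).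

Definition hyperregular (L : TB N -> R) : Prop := diffeomorphism (legendre L).

Definition external_force (F : TB N -> CTB N) : Prop :=
  smooth_map F /\ forall w, (F w).1 = w.1.

(* X is second order and, in each induced chart,
     X (dL/dqdot^k) - dL/dq^k = F_k,
   where X (dL/dqdot^k) is d/dt (dL/dqdot^k) along the integral curves of X. *)
Definition forced_EL_field (L : TB N -> R) (F : TB N -> CTB N)
    (X : TB N -> ('rV[R]_n * 'rV[R]_n)%type) : Prop :=
  smooth_vector_field X /\
  forall (w : TB N) (i : idx (TB N)), dom i w ->
    let y := coord i w in
    let a := vcomp i w (X w) in
    let Li := (fun z => L (param i z)) : 'rV[R]_n * 'rV[R]_n -> R in
    a.1 = y.2 /\
    forall k : 'I_n,
      'D_a (fun z => 'D_(0, ebase k) Li z) y - 'D_(ebase k, 0) Li y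
        = covcomp (i : idx N) w.1 (F w).2 0 k.

End ForcedLagrangian.

Section Hybrid.
Context {R : realType}.

(* Candidate hybrid flows: the index set Lambda, the times tau_i, the
   intervals I_i and the curves c_i, of which only the values on I_i matter. *)
Record hybrid_arc (D : Type) := HybridArc {
  index : set nat;
  tau : nat -> R;
  ival : nat -> set R;
  curve : nat -> R -> D }.

Definition is_index_set (Lam : set nat) : Prop :=
  Lam = setT \/ exists m, Lam = `I_m.+1.

Definition map_arc (D D' : Type) (f : D -> D') (c : hybrid_arc D) :
    hybrid_arc D' :=
  HybridArc (index c) (tau c) (ival c) (fun i t => f (curve c i t)).

(* c is the projection of c' by f, with the same index set and intervals. *)
Definition is_projection (D D' : Type) (f : D -> D') (c : hybrid_arc D)
    (c' : hybrid_arc D') : Prop :=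
  [/\ index c' = index c, tau c' = tau c, ival c' = ival c &
      forall i t, index c i -> ival c i t -> f (curve c i t) = curve c' i t].

(* Delta is only used on S. In the impact condition, c_{i+1}(tau_{i+1}) has to
   be defined, hence tau_{i+1} belongs to I_{i+1}. *)
Record solution (E : normedModType R) (D : mfd E) (X : D -> E) (S : set D)
    (Delta : D -> D) (c : hybrid_arc D) : Prop := {
  sol_index : is_index_set (index c);
  sol_ival : forall i, index c i -> index c i.+1 ->
    tau c i <= tau c i.+1 /\ ival c i = `[tau c i, tau c i.+1]%classic;
  sol_last : forall m, index c = `I_m.+1 ->
    (tau c m <= tau c m.+1 /\
      (ival c m = `[tau c m, tau c m.+1]%classic \/
       ival c m = `[tau c m, tau c m.+1[%classic))
    \/ ival c m = `[tau c m, +oo[%classic;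
  sol_curve : forall i, index c i -> integral_curve X (ival c i) (curve c i);
  sol_impact : forall i, index c i -> index c i.+1 ->
    [/\ ival c i.+1 (tau c i.+1),
        S (curve c i (tau c i.+1)) &
        Delta (curve c i (tau c i.+1)) = curve c i.+1 (tau c i.+1)] }.

Definition impact_times (D : Type) (c : hybrid_arc D) : set R :=
  [set tau c i.+1 | i in [set i | index c i /\ index c i.+1]].

Definition closed_discrete (A : set R) : Prop :=
  closed A /\
  forall t, A t -> exists2 e, 0 < e & forall s, A s -> `|s - t| < e -> s = t.

(* The switching surface is given as the image S of an embedding iota of a
   manifold Sig, whose dimension is to be dim D - 1; this identifies S with
   Sig, and the impact map S -> D with Delta \o iota. *)
Record simple_hybrid_system (E : normedModType R) (D : mfd E) (X : D -> E)
    (k : nat) (Sig : mfd 'rV[R]_k) (iota : Sig -> D) (S : set D)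
    (Delta : D -> D) : Prop := {
  shs_field : smooth_vector_field X;
  shs_surface : smooth_manifold Sig;
  shs_incl : smooth_embedding iota;
  shs_range : S = range iota;
  shs_impact : smooth_embedding (Delta \o iota);
  shs_disjoint : mclosure (Delta @` S) `&` S = set0;
  shs_times : forall c, solution X S Delta c ->
    closed_discrete (impact_times c) }.

End Hybrid.

Section Reduction.
Context {R : realType} {n : nat} (M : mfd 'rV[R]_n).

Definition Qmfd : mfd 'rV[R]_(1 + n) := prodM (circle R) M.

Definition psi (g : circle R) : Qmfd -> Qmfd := fun q => (cmul g q.1, q.2).

Definition generator (xi : R) (q : Qmfd) : 'rV[R]_(1 + n) :=
  'D_1 (fun t : R => coord (at_ q) (psi (cexp (t * xi)) q)) 0.

(* The point (theta, x, thetadot, xdot) of TQ. *)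
Definition TQpt (theta : circle R) (thetadot : R) (w : TB M) : TB Qmfd :=
  ((theta, w.1), row_mx (const_mx thetadot) w.2).

(* (theta, x, thetadot, xdot) |-> (x, xdot). *)
Definition piM (w : TB Qmfd) : TB M := (w.1.2, rsubmx w.2).

Definition momentum (L : TB Qmfd -> R) (w : TB Qmfd) : R :=
  fibre_derivative L w 0 (lshift n ord0).

Definition cyclic_theta (L : TB Qmfd -> R) : Prop :=
  forall theta theta' a w, L (TQpt theta a w) = L (TQpt theta' a w).

Definition G_regular (L : TB Qmfd -> R) : Prop :=
  forall w : TB Qmfd,
    @diffeomorphism R R R line line
      (fun xi => momentum L (w.1, w.2 + generator xi w.1)).

Definition force_theta (F : TB Qmfd -> CTB Qmfd) (w : TB Qmfd) : R :=
  (F w).2 0 (lshift n ord0).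

Definition force_x (F : TB Qmfd -> CTB Qmfd) (w : TB Qmfd) : 'rV[R]_n :=
  rsubmx (F w).2.

Record hybrid_action (L : TB Qmfd -> R) (S : set (TB Qmfd))
    (Delta : TB Qmfd -> TB Qmfd) : Prop := {
  ha_lagr : forall g w, L (tangent_map (psi g) w) = L w;
  ha_surface : forall g w, S w -> S (tangent_map (psi g) w);
  ha_impact : forall g w, S w ->
    Delta (tangent_map (psi g) w) = tangent_map (psi g) (Delta w) }.

Definition hybrid_regular_value (L : TB Qmfd -> R) (k : nat)
    (Sig : mfd 'rV[R]_k) (iota : Sig -> TB Qmfd) (mu : R) : Prop :=
  regular_value (momentum L : TB Qmfd -> line) mu /\
  regular_value (momentum L \o iota : Sig -> line) mu.

(* thetadot(x, xdot, mu).  Here and below L, F do not depend on theta, which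
   is given the value 0. *)
Definition thetadot_mu (L : TB Qmfd -> R) (mu : R) (w : TB M) : R :=
  xget 0 [set a | momentum L (TQpt (cexp 0) a w) = mu].

Definition routhian (L : TB Qmfd -> R) (mu : R) (w : TB M) : R :=
  L (TQpt (cexp 0) (thetadot_mu L mu w) w) - mu * thetadot_mu L mu w.

Definition reduced_force (L : TB Qmfd -> R) (F : TB Qmfd -> CTB Qmfd) (mu : R) :
    TB M -> CTB M :=
  fun w => (w.1, force_x F (TQpt (cexp 0) (thetadot_mu L mu w) w)).

Definition reduced_surface (L : TB Qmfd -> R) (S : set (TB Qmfd)) (mu : R) :
    set (TB M) :=
  piM @` (S `&` [set w | momentum L w = mu]).

Definition induced_impact (L : TB Qmfd -> R) (S : set (TB Qmfd))
    (Delta : TB Qmfd -> TB Qmfd) (mu : R) (Delta_mu : TB M -> TB M) : Prop :=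
  forall w, S w -> momentum L w = mu -> Delta_mu (piM w) = piM (Delta w).

Definition has_momentum (L : TB Qmfd -> R) (mu : R)
    (c : @hybrid_arc R (TB Qmfd)) : Prop :=
  forall i t, index c i -> ival c i t -> momentum L (curve c i t) = mu.

End Reduction.

(* Main.v *)
From HB Require Import structures.
Require Import Defs.
From mathcomp Require Import all_boot all_order all_algebra.
From mathcomp Require Import all_classical all_reals all_analysis.
From mathcomp Require Import ring lra.
Import Order.TTheory GRing.Theory Num.Theory numFieldNormedType.Exports.
Set Implicit Arguments.
Unset Strict Implicit.
Unset Printing Implicit Defensive.
Local Open Scope classical_set_scope.
Local Open Scope ring_scope.
(* [coord] and [index] below are those of charts and hybrid arcs. *)
Import Defs.

(** On the momentum level [mu], G-regularity makes [thetadot] a function [sigma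
    = thetadot_mu L mu] of [(x, xdot)]. Everything reduces to one pointwise
    identity, [forced_field_lift]: at the point over [w] with momentum [mu] and
    any angle, [X] is the vector with components [sigma w], [xdot], [dsigma
    (Xmu w)] and the acceleration of [Xmu w].

    That vector solves the forced Euler-Lagrange equations of [L], because
    [theta] is cyclic and unforced and the derivatives of the Routhian are
    those of [L] at [thetadot = sigma]: the terms with [dsigma] carry the
    factor [dL/dthetadot - mu], which vanishes ([routh_calculus]). And these
    equations have one solution only, because the Legendre transformation has a
    differentiable inverse on each fibre ([hyperregular_nondegenerate]). The
    differentiability of [sigma] is a scalar implicit function theorem:
    G-regularity gives a unique global solution and a nonzero derivative
    ([implicit_continuous], [implicit_differentiable], [thetadot_mu_diff]).

    A solution of momentum [mu] then projects, since dropping the angular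
    components turns [X] into [Xmu] ([integral_curve_piM]). Conversely a
    reduced solution is lifted piece by piece: the angle is a primitive of
    [sigma] along the curve ([primitive_exists], [integral_curve_lift]), and
    its initial value on a piece is the angle of the image under [Delta] of the
    end of the preceding piece. The lifted ends lie on the switching surface
    because the surface is invariant under rotations ([surface_TQpt]); the
    lifted impacts match because [Delta] preserves the momentum, and a point of
    momentum [mu] is determined by its angle and its projection
    ([momentum_eta]). *)

(** * Differential calculus of maps and curves *)

Section Differentials.
Context {R : realType}.

(** States convergence as a map on eventual properties; naming it keeps the
    filters of charts and curves folded when it is applied. *)
Lemma near_preimage (T U : Type) (f : T -> U) (F : set_system T)
    (G : set_system U) (P : U -> Prop) :
  f @ F --> G -> (\forall y \near G, P y) -> \forall x \near F, P (f x).
Proof. by move=> fFG /fFG. Qed.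

Lemma diff_remainder_le (V W : normedModType R) (f : V -> W) x : differentiable f x ->
  forall e, 0 < e ->
  \forall y \near x, `|f y - f x - 'd f x (y - x)| <= e * `|y - x|.
Proof.
move=> /diff_locallyP[_ fE] e e0.
have /eqaddoP /(_ e e0) := fE.
rewrite (near_shift 0 x) => H; apply: filterS H => h.
by rewrite !fctE /= subr0 addrK opprD addrA.
Qed.

Lemma remainder_le_diff (V W : normedModType R) (f : V -> W) (df : {linear V -> W}) x :
  continuous df ->
  (forall e, 0 < e ->
    \forall y \near x, `|f y - f x - df (y - x)| <= e * `|y - x|) ->
  differentiable f x /\ 'd f x = df :> (V -> W).
Proof.
move=> dfc H.
have E : f \o shift x = cst (f x) + df +o_ 0 id.
  apply/eqaddoP => e e0 /=; have := H e e0; rewrite (near_shift 0 x).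
  by apply: filterS => h /=; rewrite subr0 addrK !fctE opprD addrA.
have dE := diff_unique dfc E; split=> //.
by apply/diff_locallyP; rewrite dE.
Qed.

(** Differentiability and the differential are local: chart identities hold
    only near a point. *)
Lemma near_eq_diff (V W : normedModType R) (f g : V -> W) x :
  {near x, f =1 g} -> differentiable f x ->
  differentiable g x /\ 'd g x = 'd f x :> (V -> W).
Proof.
move=> fg df; apply: remainder_le_diff; first exact: diff_continuous.
move=> e e0; have := diff_remainder_le df e0; have := nbhs_singleton fg => <-.
by apply: filterS2 fg => y /= ->.
Qed.

Lemma near_translation_diff (V : normedModType R) (f : V -> V) (c x : V) :
  (\forall y \near x, f y = y + c) ->
  differentiable f x /\ 'd f x = id :> (V -> V).
Proof.
move=> fE; have dc : is_diff x (id + cst c) (id + 0) by exact: is_diffD.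
have [||df ->] := @near_eq_diff V V (id + cst c) f x; first 2 last.
- by rewrite diff_val addr0.
- by apply: filterS fE => y ->.
- exact: ex_diff.
Qed.

Lemma near_id_diff (V : normedModType R) (f : V -> V) x :
  (\forall y \near x, f y = y) -> 'd f x = id :> (V -> V).
Proof.
move=> fE; apply: (proj2 (@near_translation_diff _ _ 0 _ _)).
by apply: filterS fE => y; rewrite addr0.
Qed.

(** A directional derivative sees only the line through the point, so two
    functions on different spaces that agree along it have the same one. *)
Lemma near_eq_derive_line (V W : normedModType R) (f : V -> W) (g : R -> W)
    (y v : V) (a : R) :
  (\forall h \near (0 : R), f (h *: v + y) = g (h + a)) ->
  'D_v f y = 'D_1 g a.
Proof.
move=> fg; have := nbhs_singleton fg; rewrite /= scale0r !add0r => fga.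
rewrite /derive; congr (lim _).
rewrite eqEsubset; split; apply: near_eq_cvg; apply: cvg_within;
  apply: filterS fg => h /= fgh; rewrite [h *: 1]mulr1 fgh fga//.
Qed.

(** The velocity of [integral_curve] is a limit of difference quotients within
    an interval, one-sided at its end points; such a limit already forces
    continuity of the coordinates. *)
Lemma within_cvg_quotient_cvg (V : normedModType R) (c : R -> V) (A : set R)
    t (v : V) :
  (fun s => (s - t)^-1 *: (c s - c t)) @ within (A `\ t) (nbhs t) --> v ->
  c @ within A (nbhs t) --> c t.
Proof.
set F := within _ _; set q := (X in X @ F --> _) => qv.
have FF : Filter F by exact: within_filter.
have ctF : c s @[s --> F] --> c t.
  have st : (fun s => s - t) @ F --> (0 : R).
    rewrite -(subrr t); apply: cvgB; last exact: cvg_cst.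
    exact: cvg_within.
  have H : (fun s => (s - t) *: q s + c t) @ F --> c t.
    rewrite -[X in _ --> X]add0r -(scale0r v).
    by apply: cvgD; [exact: cvgZ|exact: cvg_cst].
  apply: cvg_trans H; apply: near_eq_cvg.
  rewrite /F near_withinE; apply: nearW => s [_ /eqP st0].
  by rewrite /= /q scalerA divff ?subr_eq0// scale1r subrK.
move=> U Uct; have := ctF U Uct; rewrite /F /= !nbhs_filterE.
rewrite /within /=; apply: filterS => s H As.
have [->|/eqP st] := eqVneq s t; first exact: nbhs_singleton.
exact: H.
Qed.

(** Chain rule along a curve for these one-sided velocities: the remainder of
    [f] is small against the increment of [c], whose quotient is bounded. *)
Lemma within_cvg_quotient_diff (V W : normedModType R) (f : V -> W)
    (c : R -> V) (A : set R) t (v : V) :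
  differentiable f (c t) ->
  (fun s => (s - t)^-1 *: (c s - c t)) @ within (A `\ t) (nbhs t) --> v ->
  (fun s => (s - t)^-1 *: (f (c s) - f (c t))) @ within (A `\ t) (nbhs t)
    --> 'd f (c t) v.
Proof.
move=> df; set F := within _ _; set q := (X in X @ F --> _) => qv.
have FF : Filter F by exact: within_filter.
have sF : \forall s \near F, s != t.
  by rewrite /F near_withinE; apply: nearW => s [_ /eqP].
have ctF : c s @[s --> F] --> c t.
  apply: cvg_trans (within_cvg_quotient_cvg qv); apply: cvg_app.
  by apply: within_subset => s [].
have qB : \forall s \near F, `|q s| <= `|v| + 1.
  by apply: cvgr_norm_le qv _ _; rewrite ltrDl.
have -> : 'd f (c t) v = 'd f (c t) v + 0 by rewrite addr0.
have dq : (fun s => 'd f (c t) (q s)) @ F --> 'd f (c t) v.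
  by apply: continuous_cvg => //; exact: diff_continuous.
suff r0 : (fun s => (s - t)^-1 *: (f (c s) - f (c t)) - 'd f (c t) (q s)) @ F
    --> (0 : W).
  apply: cvg_trans (cvgD dq r0); apply: near_eq_cvg.
  by apply: nearW => s; rewrite !fctE addrC subrK.
apply/cvgr0Pnorm_le => e e0.
have e'0 : 0 < e / (`|v| + 1) by rewrite divr_gt0// ltr_wpDl.
have /ctF H := diff_remainder_le df e'0.
apply: filterS3 sF qB H => s st0 qs H.
rewrite /q linearZ -scalerBr normrZ /=.
apply: (le_trans (ler_wpM2l _ H)) => //.
rewrite mulrCA -normrZ -/(q s).
by rewrite -mulrA -ler_pdivlMl// mulVf ?gt_eqF// mulrC ler_pdivrMr ?mul1r// ltr_wpDl.
Qed.

(** Once the implicit function [a] is continuous, expanding [G (a z, z) = G (a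
    y, y)] to first order gives [k (a z - a y) + G_y (z - y) = o(|a z - a y| +
    |z - y|)] with [k] the partial derivative in the scalar variable; as [k] is
    not zero the increment of [a] can be absorbed on the left. *)
Lemma implicit_differentiable (V : normedModType R) (G : R * V -> R)
    (a : V -> R) (mu : R) y :
  differentiable G (a y, y) -> 'd G (a y, y) (1, 0) != 0 ->
  {for y, continuous a} -> (\forall z \near y, G (a z, z) = mu) ->
  differentiable a y.
Proof.
move=> dG; set k := 'd G _ _ => k0 ca Gmu.
pose dy (v : V) : R := 'd G (a y, y) (0, v).
have dyl : linear dy.
  move=> r u v; rewrite /dy.
  have -> : (0, r *: u + v) = r *: (0, u) + (0, v) :> R * V.
    by congr pair => /=; rewrite scaler0 addr0.
  by rewrite linearP.
pose dyL : {linear V -> R} := HB.pack dy (GRing.isLinear.Build _ _ _ _ _ dyl).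
pose da (v : V) : R := - k^-1 * dy v.
have dal : linear da.
  by move=> r u v; rewrite /da dyl mulrDr; congr (_ + _); rewrite mulrCA.
pose daL : {linear V -> R} := HB.pack da (GRing.isLinear.Build _ _ _ _ _ dal).
have dac : continuous daL.
  move=> v; rewrite /= /da; apply: cvgM; first exact: cvg_cst.
  apply: (@continuous_comp _ _ _ (fun v => (0 : R, v)) ('d G (a y, y))).
    exact/differentiable_continuous/differentiable_pair.
  exact: diff_continuous.
have [C C0 HC] := linear_lipschitz dac.
apply: (proj1 (remainder_le_diff dac _)) => e e0.
(* [C] bounds the candidate differential. The first bound on [d] absorbs the
   increment of [a], the second makes what remains at most [e]. *)
pose d := Num.min (`|k| / 2) (e * `|k| / (2 * (C + 1))).
have kp : 0 < `|k| by rewrite normr_gt0.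
have C1 : 0 < C + 1 by rewrite addr_gt0.
have d0 : 0 < d by rewrite lt_min !divr_gt0// ?mulr_gt0.
have zc : (fun z => (a z, z)) @ y --> (a y, y).
  exact: (@cvg_pair _ _ _ _ _ _ _ _ _ a id ca cvg_id).
have /zc H := diff_remainder_le dG d0.
have /= Gy := nbhs_singleton Gmu.
apply: filterS2 Gmu H => z Gz.
rewrite /= Gz Gy subrr sub0r normrN /= => H.
set D := `|_ - daL _|.
have dGE : 'd G (a y, y) ((a z, z) - (a y, y)) = k * (a z - a y - daL (z - y)).
  have -> : (a z, z) - (a y, y) = (a z - a y) *: (1, 0) + (0, z - y) :> R * V.
    congr pair => /=; last by rewrite scaler0 add0r.
    by rewrite addr0 /GRing.scale/= mulr1.
  rewrite linearD linearZ /= -/k -/(dy _) mulrBr /da mulrA mulrN divff//.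
  by rewrite mulN1r opprK /GRing.scale/= mulrC.
have {H} H : `|k| * D <= d * (D + (C + 1) * `|z - y|).
  rewrite -normrM -dGE; apply: (le_trans H); rewrite (ler_wpM2l (ltW d0))//.
  have -> : `|(a z, z) - (a y, y)| = Num.max `|a z - a y| `|z - y| by [].
  rewrite ge_max; apply/andP; split => /=.
    have := HC (z - y).
    have := ler_normD (a z - a y - daL (z - y)) (daL (z - y)).
    rewrite subrK -/D => ? ?.
    have : 0 <= `|z - y| by [].
    by nra.
  have : 0 <= D by rewrite normr_ge0.
  have : 0 <= `|z - y| by [].
  by nra.
have D0 : 0 <= D by rewrite normr_ge0.
have n0 : 0 <= `|z - y| by [].
have d1 : d <= `|k| / 2 by rewrite ge_min lexx.
have d2 : d * (2 * (C + 1)) <= e * `|k|.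
  by rewrite -ler_pdivlMr ?mulr_gt0// ge_min lexx orbT.
have h1 : d * D <= `|k| / 2 * D by rewrite ler_wpM2r.
have h2 : d * (2 * (C + 1)) * `|z - y| <= e * `|k| * `|z - y| by rewrite ler_wpM2r.
rewrite -(ler_pM2l kp); lra.
Qed.

Lemma fst_is_diff (V W : normedModType R) (x : V * W) : is_diff x fst fst.
Proof.
have c : continuous (fst : V * W -> V) by move=> z; exact: cvg_fst.
apply: DiffDef; first exact: linear_differentiable.
exact: (@diff_lin R (V * W)%type V fst x c).
Qed.

Lemma snd_is_diff (V W : normedModType R) (x : V * W) : is_diff x snd snd.
Proof.
have c : continuous (snd : V * W -> W) by move=> z; exact: cvg_snd.
apply: DiffDef; first exact: linear_differentiable.
exact: (@diff_lin R (V * W)%type W snd x c).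
Qed.

Lemma rsubmx_is_diff m n (x : 'rV[R]_(m + n)) : is_diff x rsubmx rsubmx.
Proof.
apply: DiffDef; first exact: differentiable_rsubmx.
by apply: diff_lin; exact: continuous_rsubmx.
Qed.

Lemma line_is_diff (V : normedModType R) (d v : V) (t : R) :
  is_diff t (fun h => h *: d + v) ( *:%R^~ d).
Proof.
have D : is_diff t ( *:%R^~ d + cst v) ( *:%R^~ d + 0) by exact: is_diffD.
by rewrite addr0 in D.
Qed.

Lemma derive_cancel_neq0 (m g : R -> R) (a : R) :
  differentiable m a -> differentiable g (m a) -> cancel m g -> 'D_1 m a != 0.
Proof.
move=> md gd mK; apply/eqP => ma.
have dm : derivable m a 1 by exact: diff_derivable.
have dg : derivable g (m a) 1 by exact: diff_derivable.
have := derive1_comp dm dg.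
have -> : g \o m = id by apply/funext => x; exact: mK.
by rewrite derive1_id (derive1E m a) ma mulr0 => /eqP; rewrite oner_eq0.
Qed.

(** [row_mx] as a linear map of one argument, to which the calculus of
    differentials applies. *)
Definition row_pair m n (p : 'rV[R]_m * 'rV[R]_n) : 'rV[R]_(m + n) :=
  row_mx p.1 p.2.

Fact row_pair_linear m n : linear (@row_pair m n).
Proof.
by move=> r [u v] [u' v']; rewrite /row_pair /= scale_row_mx add_row_mx.
Qed.

HB.instance Definition _ m n :=
  GRing.isLinear.Build R _ _ _ (@row_pair m n) (@row_pair_linear m n).

Lemma row_pair_continuous m n : continuous (@row_pair m n).
Proof.
move=> [u v] A /nbhs_ballP[e /= e0 eA].
apply/nbhs_ballP; exists e => //= -[u' v'] [[_ /= uu'] [_ /= vv']].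
apply: eA; split => // i j; rewrite !mxE.
by case: fintype.split => k; [exact: uu'|exact: vv'].
Qed.

Lemma row_mx_diff (V : normedModType R) m n (f : V -> 'rV[R]_m)
    (g : V -> 'rV[R]_n) x : differentiable f x -> differentiable g x ->
  differentiable (fun y => row_mx (f y) (g y)) x /\
  'd (fun y => row_mx (f y) (g y)) x = (fun v => row_mx ('d f x v) ('d g x v))
    :> (V -> _).
Proof.
move=> df dg.
have dr z := linear_differentiable z (@row_pair_continuous m n).
have dp := differentiable_pair df dg.
rewrite -[fun y => row_mx _ _]/(@row_pair m n \o (fun y => (f y, g y))).
split; first exact: differentiable_comp.
by rewrite diff_comp// diff_lin ?diff_pair//; exact: row_pair_continuous.
Qed.

Lemma const_mx_is_diff (V : normedModType R) (f df : V -> R) x :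
  is_diff x f df ->
  is_diff x (fun y => const_mx (f y) : 'rV[R]_1) (fun v => const_mx (df v)).
Proof.
move=> fx.
have cE (g : V -> R) :
    (fun y => const_mx (g y) : 'rV[R]_1) = fun y => g y *: const_mx 1.
  by apply/funext => y; apply/rowP => i; rewrite !mxE mulr1.
apply: DiffDef; first by rewrite cE; exact: differentiableZl.
by rewrite !cE diffZl// diff_val.
Qed.

Lemma row_mx_is_diff (V : normedModType R) m n (f df : V -> 'rV[R]_m)
    (g dg : V -> 'rV[R]_n) x : is_diff x f df -> is_diff x g dg ->
  is_diff x (fun y => row_mx (f y) (g y)) (fun v => row_mx (df v) (dg v)).
Proof.
move=> fx gx; have [D E] := row_mx_diff
  (@ex_diff _ _ _ _ _ _ _ fx) (@ex_diff _ _ _ _ _ _ _ gx).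
by apply: DiffDef => //; rewrite E !diff_val.
Qed.

End Differentials.

(** * Atlases with differentiable transition maps *)

Section Atlases.
Context {R : realType}.

(** The first-order content of [smooth_manifold]: what vectors, covectors and
    velocities involve, and what passes directly to the circle and to products.
    Openness of the overlaps is put in the pointwise form in which it is used.
    *)
Record C1_atlas (E : normedModType R) (N : mfd E) : Prop := {
  at_dom : forall p : N, dom (at_ p) p;
  chartK : forall (i : idx N) (p : N), dom i p -> param i (coord i p) = p;
  near_chart : forall (i j : idx N) (p : N), dom i p -> dom j p ->
    \forall y \near coord i p,
      [/\ dom i (param i y), dom j (param i y) & coord i (param i y) = y];
  diff_transition : forall (i j : idx N) (p : N), dom i p -> dom j p ->
    differentiable (coord j \o param i) (coord i p) }.

(** Stated from the inversion [coordK] in order to cover tangent bundles, where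
    it is [TB_chartK]. *)
Lemma mopenP (E : normedModType R) (N : mfd E)
    (coordK : forall (i : idx N) (p : N), dom i p -> param i (coord i p) = p)
    (U : set N) :
  mopen U <-> forall (i : idx N) p, dom i p -> U p -> \forall y \near coord i p,
    [/\ U (param i y), dom i (param i y) & coord i (param i y) = y].
Proof.
split=> [Uo i p ip Up|H i].
  have := open_nbhs_nbhs (conj (Uo i) (ex_intro2 _ _ p (conj Up ip) erefl)).
  by apply: filterS => y [q [Uq iq] <-]; rewrite coordK.
rewrite openE => _ [p [Up ip] <-]; apply: filterS (H i p ip Up) => y [Uy iy yE].
by exists (param i y).
Qed.

Lemma smooth_C1_atlas (E : normedModType R) (N : mfd E) :
  smooth_manifold N -> C1_atlas N.
Proof.
move=> [da cK oo ts _ _]; split=> //.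
  move=> i j p ip jp.
  have := open_nbhs_nbhs (conj (oo i j) (ex_intro2 _ _ p (conj ip jp) erefl)).
  by apply: filterS => y [q [iq jq] <-]; rewrite cK.
by move=> i j p ip jp; have [+ _] := ts i j 1%N; apply; exists p.
Qed.

Section Tangent.
Context {E : normedModType R} {N : mfd E} (atl : C1_atlas N).

(** Opposite transition maps compose to the identity near the point. *)
Lemma transitionK (i j : idx N) (p : N) (v : E) : dom i p -> dom j p ->
  'd (coord i \o param j) (coord j p) ('d (coord j \o param i) (coord i p) v)
    = v.
Proof.
move=> ip jp.
have dij := diff_transition atl ip jp; have dji := diff_transition atl jp ip.
have E1 : (coord j \o param i) (coord i p) = coord j p.
  by rewrite /= (chartK atl).
have := @near_id_diff R E
  ((coord i \o param j) \o (coord j \o param i)) (coord i p).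
rewrite diff_comp ?E1// => /(_ _)/(congr1 (fun f => f v)) /= -> //.
by apply: filterS (near_chart atl ip jp) => y [iy jy yE]; rewrite (chartK atl).
Qed.

(** In the preferred chart at a point, components of vectors (here), of second
    tangent vectors ([TB_vcomp_at]) and of covectors ([covcomp_at]) are the
    stored ones. *)
Lemma vcomp_at (p : N) (v : E) : vcomp (at_ p) p v = v.
Proof.
rewrite /vcomp; have ap := at_dom atl p.
rewrite near_id_diff//.
by apply: filterS (near_chart atl ap ap) => y [].
Qed.

Lemma TB_chartK (i : idx (TB N)) (w : TB N) : dom i w ->
  param i (coord i w) = w.
Proof.
case: w => p v ip; rewrite /= (chartK atl)//; congr pair.
by rewrite transitionK//; exact: at_dom.
Qed.

Lemma TB_coordK (i : idx (TB N)) (y : E * E) :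
  dom (i : idx N) (param (i : idx N) y.1) ->
  coord (i : idx N) (param (i : idx N) y.1) = y.1 -> coord i (param i y) = y.
Proof.
case: y => y v /= iy yE; rewrite yE; congr pair.
rewrite /vcomp -[X in 'd _ X v]yE transitionK//; exact: at_dom.
Qed.

Lemma near_TB_chart (i j : idx N) (w : TB N) : dom i w.1 -> dom j w.1 ->
  \forall y \near coord (i : idx (TB N)) w,
   [/\ dom (i : idx (TB N)) (param (i : idx (TB N)) y),
       dom (j : idx (TB N)) (param (i : idx (TB N)) y) &
       coord (i : idx (TB N)) (param (i : idx (TB N)) y) = y].
Proof.
move=> iw jw.
have F : (fst : E * E -> E) @ (coord (i : idx (TB N)) w) --> coord i w.1.
  exact: cvg_fst.
apply: filterS (near_preimage F (near_chart atl iw jw)) => y /= [iy jy yE].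
by split=> //; exact: TB_coordK.
Qed.

Lemma TB_vcomp_at (w : TB N) (a : E * E) : vcomp (at_ w) w a = a.
Proof.
rewrite /vcomp.
rewrite near_id_diff//.
by apply: filterS (near_TB_chart (at_dom atl w.1) (at_dom atl w.1)) => y [].
Qed.

Lemma mopen_dom_TB (j : idx N) : mopen [set w : TB N | dom j w.1].
Proof.
by apply/(mopenP TB_chartK) => i w iw jw; apply: filterS (near_TB_chart iw jw)
  => y [].
Qed.

End Tangent.

Lemma covcomp_at (n : nat) (N : mfd 'rV[R]_n) (atl : C1_atlas N) (p : N)
    (a : 'rV[R]_n) : covcomp (at_ p) p a = a.
Proof.
apply/rowP => k; rewrite mxE (bigD1 k)//= big1 ?addr0.
  have := vcomp_at atl p (ebase k); rewrite /vcomp => ->.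
  by rewrite /ebase mxE !eqxx mulr1.
move=> j jk; have := vcomp_at atl p (ebase k); rewrite /vcomp => ->.
by rewrite /ebase mxE eqxx (negbTE jk) mulr0.
Qed.

End Atlases.

(** * The circle and products *)

Section CircleCharts.
Context {R : realType}.
Implicit Types (s t u v a : R) (z g : circle R).

Lemma cexpD s t : cexp (s + t) = cmul (cexp s) (cexp t).
Proof.
by apply: val_inj => /=; rewrite /cmul_pair /= cosD sinD [in RHS]addrC
  [sin s * cos t]mulrC [X in X + _]mulrC addrC; congr pair; ring.
Qed.

(** [cos (s - t) = 1], and cosine is injective on [0, pi]; beyond [pi] reflect
    [|s - t|] to [2 pi - |s - t|]. *)
Lemma cexp_inj s t : cexp s = cexp t -> `|s - t| < pi *+ 2 -> s = t.
Proof.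
move=> /(congr1 val) /= [cE sE] d2.
have cd : cos `|s - t| = 1.
  by rewrite cos_norm cosB cE sE -!expr2 cos2Dsin2.
apply/eqP; rewrite -subr_eq0 -normr_eq0; apply/eqP.
have [dpi|dpi] := leP `|s - t| pi.
  by apply: cos_inj; rewrite ?cos0// in_itv/= ?lexx ?pi_ge0 ?normr_ge0.
have c2 : cos (pi *+ 2 - `|s - t|) = 1.
  by rewrite cosB cos2pi sin2pi cd mul0r addr0 mulr1.
have : pi *+ 2 - `|s - t| = 0.
  apply: cos_inj; rewrite ?cos0// in_itv/= ?lexx ?pi_ge0//.
  by rewrite subr_ge0 ltW//= lerBlDr mulr2n lerD2l ltW.
by move=> /eqP; rewrite subr_eq0 => /eqP E; rewrite E ltxx in d2.
Qed.

Lemma cexp_surj z : exists t, cexp t = z.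
Proof.
case: z => -[x y] /= xy; have /eqP /= E := xy.
have x1 : -1 <= x <= 1 by apply/andP; split; nra.
have sE : sin (acos x) = `|y|.
  by rewrite sin_acos// -E addrAC subrr add0r sqrtr_sqr.
have cE : cos (acos x) = x by rewrite acosK.
have [y0|y0] := leP 0 y.
  by exists (acos x); apply: val_inj; rewrite /= sE cE ger0_norm.
by exists (- acos x); apply: val_inj; rewrite /= sinN cosN sE cE ltr0_norm// opprK.
Qed.

Lemma cmul_cexp0 z : cmul z (cexp 0) = z.
Proof. by have [t <-] := cexp_surj z; rewrite -cexpD addr0. Qed.

Lemma cexp_at z : cexp (at_ z) = z.
Proof. exact: (@xgetPex _ 0 [set t | cexp t = z] (cexp_surj z)). Qed.

Lemma circle_domP a z :
  dom (a : idx (circle R)) z <-> exists t, a - pi < t < a + pi /\ cexp t = z.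
Proof.
split=> [[t /=]|[t [tI <-]]]; rewrite ?in_itv/=; first by exists t.
by exists t.
Qed.

Lemma circle_coordE a t : a - pi < t < a + pi ->
  coord (a : idx (circle R)) (cexp t : circle R) = const_mx t.
Proof.
move=> tI; rewrite /=; congr const_mx.
apply: (@xget_unique _ 0 [set s | a - pi < s < a + pi /\ cexp s = cexp t]) => //.
move=> s [sI st]; apply: cexp_inj => //.
by move: sI tI => /andP[? ?] /andP[? ?]; rewrite mulr2n ltr_norml;
  apply/andP; split; lra.
Qed.

Lemma circle_window a : a - pi < a < a + pi.
Proof. by rewrite ltrDl ltrBlDr ltrDl pi_gt0. Qed.

Lemma coord_at_circle z : coord (at_ z) z = const_mx (at_ z : R).
Proof.
by rewrite -[X in coord _ X = _](cexp_at z) circle_coordE//; exact: circle_window.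
Qed.

(** Every branch of the angle is locally a translation: adding to [s] the
    difference of two angles of one point does not move [cexp s]. *)
Lemma near_circle_coord a u v : cexp u = cexp v -> a - pi < v < a + pi ->
  \forall s \near u, dom (a : idx (circle R)) (cexp s) /\
    coord (a : idx (circle R)) (cexp s : circle R) = const_mx (s + (v - u)).
Proof.
move=> uv /andP[v1 v2].
have : \forall s \near u, a - pi - (v - u) < s < a + pi - (v - u).
  near=> s; apply/andP; split; near: s.
    by apply: lt_nbhsr; lra.
  by apply: lt_nbhsl; lra.
apply: filterS => s /andP[s1 s2].
have sI : a - pi < s + (v - u) < a + pi by apply/andP; split; lra.
have -> : cexp s = cexp (s + (v - u)).
  by rewrite addrCA [RHS]cexpD -[in LHS](subrK u s) addrC
    cexpD uv -cexpD -[in RHS]cexpD; congr cexp; ring.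
split; last exact: circle_coordE.
by apply/circle_domP; exists (s + (v - u)).
Unshelve. all: by end_near. Qed.

Lemma circle_transition a b z : dom (a : idx (circle R)) z ->
  dom (b : idx (circle R)) z ->
  exists c : 'rV[R]_1, \forall y \near coord (a : idx (circle R)) z,
    [/\ dom (a : idx (circle R)) (cexp ((y : 'rV[R]_1) 0 0)),
        dom (b : idx (circle R)) (cexp (y 0 0)),
        coord (a : idx (circle R)) (cexp (y 0 0) : circle R) = y &
        coord (b : idx (circle R)) (cexp (y 0 0) : circle R) = y + c].
Proof.
move=> /circle_domP[t [tI tz]] /circle_domP[t' [tI' tz']].
exists (const_mx (t' - t)); rewrite -tz circle_coordE//.
have F : (fun y : 'rV[R]_1 => y 0 0) @ (const_mx t : 'rV[R]_1) --> t.
  have := @coord_continuous R 1 1 0 0 (const_mx t).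
  by rewrite /continuous_at mxE.
have ttE : cexp t = cexp t' by rewrite tz tz'.
have H1 := near_preimage F (near_circle_coord (erefl (cexp t)) tI).
have H2 := near_preimage F (near_circle_coord ttE tI').
apply: filterS2 H1 H2 => y [d1 c1] [d2 c2]; split=> //.
  by rewrite c1 subrr addr0; apply/rowP => i; rewrite mxE !ord1.
by rewrite c2; apply/rowP => i; rewrite !mxE !ord1.
Qed.

Lemma circle_C1_atlas : C1_atlas (circle R).
Proof.
split.
- move=> z; apply/circle_domP; exists (at_ z); split; last exact: cexp_at.
  exact: circle_window.
- by move=> a z /circle_domP[t [tI <-]]; rewrite circle_coordE//= mxE.
- move=> a b z az bz; have [c] := circle_transition az bz.
  by apply: filterS => y [].
- move=> a b z az bz; have [c H] := circle_transition az bz.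
  apply: (proj1 (@near_translation_diff _ _ _ c _ _)).
  by apply: filterS H => y [].
Qed.

Lemma circle_vcomp a b z (v : 'rV[R]_1) :
  dom (a : idx (circle R)) z -> dom (b : idx (circle R)) z ->
  'd (coord (b : idx (circle R)) \o param (a : idx (circle R)))
     (coord (a : idx (circle R)) z) v = v.
Proof.
move=> az bz; have [c H] := circle_transition az bz.
rewrite (proj2 (@near_translation_diff _ _ _ c _ _))//.
by apply: filterS H => y [].
Qed.

End CircleCharts.

Section Product.
Context {R : realType} {m n : nat}.
Context {N : mfd 'rV[R]_m} {P : mfd 'rV[R]_n}.
Context (aN : C1_atlas N) (aP : C1_atlas P).

(** Block-diagonality of the transition maps of a product: vectors of S^1 x M
    split into an angular and a base part in every chart. *)
Lemma prodM_transition_diff (i j : idx (prodM N P)) (p : prodM N P) :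
  dom i p -> dom j p ->
  differentiable (coord j \o param i) (coord i p) /\
  forall u v, 'd (coord j \o param i) (coord i p) (row_mx u v) =
    row_mx ('d (coord j.1 \o param i.1) (coord i.1 p.1) u)
           ('d (coord j.2 \o param i.2) (coord i.2 p.2) v).
Proof.
move=> [i1 i2] [j1 j2].
have dl := @differentiable_lsubmx R 1 m n (coord i p).
have dr := @differentiable_rsubmx R 1 m n (coord i p).
have d1 := diff_transition aN i1 j1.
have d2 := diff_transition aP i2 j2.
have El : lsubmx (coord i p) = coord i.1 p.1 by rewrite /= row_mxKl.
have Er : rsubmx (coord i p) = coord i.2 p.2 by rewrite /= row_mxKr.
rewrite -El in d1; rewrite -Er in d2.
have [] := row_mx_diff (differentiable_comp dl d1) (differentiable_comp dr d2).
rewrite -[fun y => row_mx _ _]/(coord j \o param i) => D E.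
split=> // u v; rewrite E !diff_comp//= El Er.
rewrite !diff_lin; last first.
- exact: continuous_lsubmx.
- exact: continuous_rsubmx.
by rewrite /= row_mxKl row_mxKr.
Qed.

Lemma prodM_C1_atlas : C1_atlas (prodM N P).
Proof.
split.
- by move=> p; split; exact: at_dom.
- by move=> i [p q] [ip iq]; rewrite /= row_mxKl row_mxKr !chartK.
- move=> i j p [i1 i2] [j1 j2].
  have Fl : lsubmx @ coord i p --> coord i.1 p.1.
    rewrite -[X in _ --> X](row_mxKl _ (coord i.2 p.2)).
    exact: continuous_lsubmx.
  have Fr : rsubmx @ coord i p --> coord i.2 p.2.
    rewrite -[X in _ --> X](row_mxKr (coord i.1 p.1)).
    exact: continuous_rsubmx.
  have H1 := near_preimage Fl (near_chart aN i1 j1).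
  have H2 := near_preimage Fr (near_chart aP i2 j2).
  apply: filterS2 H1 H2 => y [a1 b1 c1] [a2 b2 c2]; split=> //=.
  by rewrite c1 c2 hsubmxK.
- by move=> i j p ip jp; have [] := prodM_transition_diff ip jp.
Qed.

End Product.

(** * Charts of the tangent bundle of S^1 x M *)

Section TQ.
Context {R : realType} {n : nat} {M : mfd 'rV[R]_n} (aM : C1_atlas M).
Notation Q := (Qmfd M).
Notation EQ := ('rV[R]_(1 + n) * 'rV[R]_(1 + n))%type.
Notation EM := ('rV[R]_n * 'rV[R]_n)%type.

Lemma Q_C1_atlas : C1_atlas Q.
Proof. exact: prodM_C1_atlas circle_C1_atlas aM. Qed.
Notation aQ := Q_C1_atlas.

Lemma TQpt_eta (w : TB Q) : w = TQpt w.1.1 (w.2 0 (lshift n ord0)) (piM w).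
Proof.
case: w => -[z x] v; rewrite /TQpt /piM /=; congr pair.
rewrite -[LHS]hsubmxK; congr row_mx.
by apply/rowP => k; rewrite !mxE ord1; congr (v _ (lshift _ _)); apply: val_inj.
Qed.

Lemma piM_TQpt z a (w : TB M) : piM (TQpt z a w) = w.
Proof. by case: w => x v; rewrite /piM /= row_mxKr. Qed.

Lemma coord_TQ (i : idx Q) (w : TB Q) : dom i w.1 ->
  coord (i : idx (TB Q)) w =
    (row_mx (coord i.1 w.1.1) (coord i.2 w.1.2),
     row_mx (lsubmx w.2) (vcomp i.2 w.1.2 (rsubmx w.2))).
Proof.
move=> iw; rewrite /=; congr pair; rewrite -[X in vcomp _ _ X]hsubmxK /vcomp.
have [_ ->] := prodM_transition_diff circle_C1_atlas aM (at_dom aQ w.1) iw.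
by rewrite circle_vcomp//; [exact: at_dom circle_C1_atlas _|case: iw].
Qed.

Definition proj_piM (y : EQ) : EM := (rsubmx y.1, rsubmx y.2).

Lemma proj_piM_is_diff y : is_diff y proj_piM proj_piM.
Proof.
apply: is_diff_pair.
  exact: (@is_diff_comp _ _ _ _ fst fst rsubmx rsubmx _ (fst_is_diff _)
    (rsubmx_is_diff _)).
exact: (@is_diff_comp _ _ _ _ snd snd rsubmx rsubmx _ (snd_is_diff _)
  (rsubmx_is_diff _)).
Qed.

Lemma proj_piM_continuous : continuous proj_piM.
Proof.
move=> y; apply: differentiable_continuous.
exact: (ex_diff (is_diff_def:=proj_piM_is_diff y)).
Qed.

(** In charts the reduction map just drops the angular components. *)
Lemma coord_piM (i : idx Q) (w : TB Q) : dom i w.1 ->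
  coord (i.2 : idx (TB M)) (piM w) = proj_piM (coord (i : idx (TB Q)) w).
Proof. by move=> iw; rewrite coord_TQ// /proj_piM /= !row_mxKr. Qed.

Lemma mopen_piM (U : set (TB M)) : mopen U -> mopen (@piM R n M @^-1` U).
Proof.
move=> Uo; apply/(mopenP (TB_chartK aQ)) => i w iw Uw.
have Uo' := proj1 (mopenP (TB_chartK aM) U) Uo (i.2 : idx (TB M)) (piM w) iw.2 Uw.
have F : proj_piM @ coord (i : idx (TB Q)) w --> coord (i.2 : idx (TB M)) (piM w).
  by rewrite coord_piM//; exact: proj_piM_continuous.
apply: filterS2 (near_preimage F Uo') (near_TB_chart aQ iw iw)
  => y [Uy _ _] [iy _ yE].
split=> //; rewrite /preimage /=.
set w' := param _ _ in iy yE *.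
have : coord (i.2 : idx (TB M)) (piM w') = proj_piM y by rewrite coord_piM// yE.
by move=> wE; move: Uy; rewrite -wE (TB_chartK aM)//; case: iy.
Qed.

(** Rotations are translations of the angle in charts, so their tangent maps
    leave components unchanged. *)
Lemma tangent_psi (g : circle R) (q : Q) (v : 'rV[R]_(1 + n)) :
  tangent_at (psi g) q v = v.
Proof.
rewrite /tangent_at.
have [c gc] := cexp_surj g.
set a := at_ q; set b := at_ (psi g q).
have ca : cexp (a.1 : R) = q.1 by exact: cexp_at.
have cb : cexp (b.1 : R) = cexp (c + a.1) by rewrite cexp_at cexpD ca gc.
have bI : (b.1 : R) - pi < b.1 < b.1 + pi by exact: circle_window.
have aI : (a.1 : R) - pi < a.1 < a.1 + pi by exact: circle_window.
have F : (fun y : 'rV[R]_(1 + n) => c + (lsubmx y) 0 0) @ coord a q --> c + a.1.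
  suff G : (fun y : 'rV[R]_(1 + n) => lsubmx y 0 0) @ coord a q --> (a.1 : R).
    exact: (cvgD (cvg_cst c) G).
  have -> : (a.1 : R) = (lsubmx (coord a q) : 'rV[R]_1) 0 0.
    by rewrite [coord a q]/(row_mx (coord a.1 q.1) _) row_mxKl coord_at_circle mxE.
  apply: (@continuous_comp _ _ _ lsubmx (fun u : 'rV[R]_1 => u 0 0)).
    exact: continuous_lsubmx.
  exact: coord_continuous.
have Fr : rsubmx @ coord a q --> coord a.2 q.2.
  rewrite -[X in _ --> X](row_mxKr (coord a.1 q.1)).
  exact: continuous_rsubmx.
have H1 := near_preimage F (near_circle_coord (esym cb) bI).
have H2 := near_preimage Fr (near_chart aM (at_dom aM q.2) (at_dom aM q.2)).
pose k : 'rV[R]_(1 + n) := row_mx (const_mx ((b.1 : R) - a.1)) 0.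
rewrite (proj2 (@near_translation_diff _ _ _ k _ _))//.
apply: filterS2 H1 H2 => y [_ c1] [_ _ c2].
have -> : (coord b \o psi g \o param a) y =
    row_mx (coord b.1 (cexp (c + lsubmx y 0 0) : circle R))
           (coord a.2 (param a.2 (rsubmx y))) by rewrite cexpD gc.
rewrite c1 c2 -[in RHS](hsubmxK y) /k add_row_mx addr0.
by congr row_mx; apply/rowP => l; rewrite !mxE !ord1; ring.
Qed.

Lemma tangent_psiE g (w : TB Q) : tangent_map (psi g) w = (psi g w.1, w.2).
Proof. by rewrite /tangent_map tangent_psi. Qed.

Lemma tangent_psi_TQpt g z a (w : TB M) :
  tangent_map (psi g) (TQpt z a w) = TQpt (cmul g z) a w.
Proof. by rewrite tangent_psiE. Qed.

Lemma generatorE xi (q : Q) : generator xi q = row_mx (const_mx xi) 0.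
Proof.
rewrite /generator; set a := at_ q.
have ca : cexp (a.1 : R) = q.1 by exact: cexp_at.
have aI : (a.1 : R) - pi < a.1 < a.1 + pi by exact: circle_window.
pose e : 'rV[R]_(1 + n) := row_mx (const_mx xi) 0.
rewrite (@near_eq_derive _ _ _ _ (fun t : R => t *: e + coord a q)).
  have D : is_diff (0 : R) ( *:%R^~ e + cst (coord a q)) ( *:%R^~ e + 0).
    exact: is_diffD.
  have -> : (fun t : R => t *: e + coord a q) = *:%R^~ e + cst (coord a q) by [].
  by rewrite deriveE// diff_val addr0 scale1r.
have F : (fun t : R => t * xi + a.1) @ (0 : R) --> (a.1 : R).
  have : (fun t : R => t * xi + a.1) @ (0 : R) --> 0 * xi + a.1.
    exact: (cvgD (cvgM (@cvg_id _ (nbhs (0 : R))) (cvg_cst xi)) (cvg_cst (a.1 : R))).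
  by rewrite mul0r add0r.
apply: filterS (near_preimage F (near_circle_coord (erefl (cexp (a.1 : R))) aI)).
move=> t [_ cE].
have -> : coord a (psi (cexp (t * xi)) q) =
    row_mx (coord a.1 (cexp (t * xi + a.1) : circle R)) (coord a.2 q.2).
  by rewrite cexpD ca.
rewrite cE -[coord a q]/(row_mx (coord a.1 q.1) (coord a.2 q.2)).
rewrite coord_at_circle /e scale_row_mx add_row_mx scaler0 add0r.
by congr row_mx; apply/rowP => l; rewrite !mxE subrr addr0.
Qed.

End TQ.

(** * Projecting and lifting integral curves *)

Section Curves.
Context {R : realType} {n : nat} {M : mfd 'rV[R]_n} (aM : C1_atlas M).
Notation Q := (Qmfd M).
Notation EQ := ('rV[R]_(1 + n) * 'rV[R]_(1 + n))%type.
Notation EM := ('rV[R]_n * 'rV[R]_n)%type.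
Notation aQ := (Q_C1_atlas aM).

(** The chart point or vector with angular components [s], [a] and base
    components [x], [v], in the order of (theta, x, thetadot, xdot). *)
Definition row_chart (s : R) (x : 'rV[R]_n) (a : R) (v : 'rV[R]_n) : EQ :=
  (row_mx (const_mx s) x, row_mx (const_mx a) v).

Lemma row_chart_is_diff (V : normedModType R) (s ds a da : V -> R)
    (x dx v dv : V -> 'rV[R]_n) y :
  is_diff y s ds -> is_diff y x dx -> is_diff y a da -> is_diff y v dv ->
  is_diff y (fun z => row_chart (s z) (x z) (a z) (v z))
    (fun h => row_chart (ds h) (dx h) (da h) (dv h)).
Proof.
move=> ? ? ? ?; apply: is_diff_pair; apply: row_mx_is_diff => //;
  exact: const_mx_is_diff.
Qed.

Lemma integral_curve_near_dom (E : normedModType R) (N : mfd E)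
    (aN : C1_atlas N) (X : TB N -> E * E) (I : set R) (c : R -> TB N) t :
  integral_curve X I c -> I t ->
  \forall s \near within I (nbhs t), dom (at_ (c t).1) (c s).1.
Proof.
move=> cX It; have [+ _] := cX t It.
by move=> H; exact: (H _ (@mopen_dom_TB _ _ _ aN _) (at_dom aN _)).
Qed.

Lemma near_within_subset (I : set R) t (P : R -> Prop) :
  (\forall s \near within I (nbhs t), P s) ->
  \forall s \near within (I `\ t) (nbhs t), P s.
Proof. by apply: within_subset => s []. Qed.

Lemma integral_curve_piM (X : TB Q -> EQ) (Xmu : TB M -> EM) (I : set R)
    (c : R -> TB Q) :
  (forall t, I t -> proj_piM (X (c t)) = Xmu (piM (c t))) ->
  integral_curve X I c -> integral_curve Xmu I (fun t => piM (c t)).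
Proof.
move=> XE cX t It; have [cc cq] := cX t It; split.
  by move=> U Uo Uc; exact: (cc _ (mopen_piM aM Uo) Uc).
rewrite -XE//.
have pd y := @proj_piM_is_diff R n y.
have := within_cvg_quotient_diff (ex_diff (is_diff_def:=pd _)) cq.
rewrite diff_val.
apply: cvg_trans; apply: near_eq_cvg.
apply: filterS (near_within_subset (integral_curve_near_dom aQ cX It)) => s sD.
congr (_ *: (_ - _)); last by rewrite -coord_piM//; exact: at_dom aQ _.
by rewrite -coord_piM.
Qed.

(** The lifted curve has the velocity of [X] because in the chart at [t] it is
    [F (P s - P t, cbar s)] for a differentiable [F]: the angle coordinate
    moves by [P s - P t], and the angular velocity is [sigma] of the base
    curve. Its continuity is read off from these coordinates. *)
Lemma integral_curve_lift (X : TB Q -> EQ) (Xmu : TB M -> EM) (I : set R)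
    (cbar : R -> TB M) (sigma : TB M -> R) (P : R -> R) (z : circle R) :
  let lift := fun t => TQpt (cmul z (cexp (P t))) (sigma (cbar t)) (cbar t) in
  let sigma_ := fun t => sigma \o param (at_ (cbar t)) in
  integral_curve Xmu I cbar ->
  (forall t, I t ->
    (fun s => (s - t)^-1 *: (P s - P t)) @ within (I `\ t) (nbhs t)
      --> sigma (cbar t)) ->
  (forall t, I t ->
    differentiable (sigma_ t) (coord (at_ (cbar t)) (cbar t))) ->
  (forall t, I t -> X (lift t) =
     row_chart (sigma (cbar t)) (Xmu (cbar t)).1
       ('d (sigma_ t) (coord (at_ (cbar t)) (cbar t)) (Xmu (cbar t)))
       (Xmu (cbar t)).2) ->
  integral_curve X I lift.
Proof.
move=> lift sigma_ cX Pd sd XE t It.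
have [cc cq] := cX t It.
have [t0 t0z] := cexp_surj z.
have liftE s : (lift s).1.1 = cexp (t0 + P s) by rewrite cexpD t0z.
set i : idx (TB Q) := at_ (lift t).
set j : idx (TB M) := at_ (cbar t).
pose a : R := (i : idx Q).1.
have ca : cexp a = cexp (t0 + P t) by rewrite -liftE /a cexp_at.
have aI : a - pi < a < a + pi by exact: circle_window.
have Pc := within_cvg_quotient_cvg (Pd t It).
have near_th : \forall s \near within I (nbhs t),
    dom (a : idx (circle R)) (lift s).1.1 /\
    coord (a : idx (circle R)) (lift s).1.1 = const_mx (P s - P t + a).
  have F : (fun s => t0 + P s) @ within I (nbhs t) --> t0 + P t.
    exact: (cvgD (cvg_cst t0) Pc).
  apply: filterS (near_preimage F (near_circle_coord (esym ca) aI)) => s.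
  rewrite liftE => -[? ->]; split=> //; congr const_mx; ring.
have near_x := integral_curve_near_dom aM cX It.
pose F (p : R * EM) : EQ := row_chart (p.1 + a) p.2.1 (sigma_ t p.2) p.2.2.
pose g s : R * EM := (P s - P t, coord j (cbar s)).
have near_dom : \forall s \near within I (nbhs t), dom (i : idx Q) (lift s).1.
  by apply: filterS2 near_th near_x => s [].
have near_F : \forall s \near within I (nbhs t), coord i (lift s) = F (g s).
  apply: filterS2 near_th near_x => s [d1 c1] d2.
  rewrite coord_TQ// c1.
  have sE : sigma_ t (coord j (cbar s)) = sigma (cbar s).
    by rewrite /sigma_ /comp (TB_chartK aM).
  rewrite /F /row_chart sE.
  by rewrite [(lift s).2]/(row_mx (const_mx (sigma (cbar s))) (cbar s).2)
    row_mxKl row_mxKr.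
have Ft : coord i (lift t) = F (g t).
  by have := near_F; rewrite near_withinE => /nbhs_singleton /(_ It).
pose dF (h : R * EM) :=
  row_chart h.1 h.2.1 ('d (sigma_ t) (coord j (cbar t)) h.2) h.2.2.
have Fd : is_diff (g t) F dF.
  apply: row_chart_is_diff.
  - rewrite -[X in is_diff _ _ X]addr0.
    exact: (@is_diffD _ _ _ fst (cst a) fst 0 _ (fst_is_diff _) (is_diff_cst _ _)).
  - exact: (@is_diff_comp _ _ _ _ snd snd fst fst _ (snd_is_diff _) (fst_is_diff _)).
  - have sd' : is_diff ((g t).2) (sigma_ t) ('d (sigma_ t) (coord j (cbar t))).
      exact: (differentiableP (sd t It)).
    exact: (@is_diff_comp _ _ _ _ snd snd _ _ _ (snd_is_diff _) sd').
  - exact: (@is_diff_comp _ _ _ _ snd snd snd snd _ (snd_is_diff _) (snd_is_diff _)).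
have gq : (fun s => (s - t)^-1 *: (g s - g t)) @ within (I `\ t) (nbhs t) -->
    (sigma (cbar t), Xmu (cbar t)).
  have FF : Filter (within (I `\ t) (nbhs t)) by exact: within_filter.
  apply: cvg_trans (@cvg_pair _ _ _ _ _ _ _ _ _ _ _ (Pd t It) cq).
  apply: near_eq_cvg; apply: nearW => s.
  by rewrite /g subrr; congr pair; rewrite /= subr0.
have qF := within_cvg_quotient_diff (ex_diff (is_diff_def:=Fd)) gq.
rewrite diff_val in qF.
have q : (fun s => (s - t)^-1 *: (coord i (lift s) - coord i (lift t)))
    @ within (I `\ t) (nbhs t) --> X (lift t).
  rewrite XE//; apply: cvg_trans qF; apply: near_eq_cvg.
  by apply: filterS (near_within_subset near_F) => s ->; rewrite Ft.
split=> // U Uo Ut.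
have := proj1 (mopenP (TB_chartK aQ) U) Uo i (lift t) (at_dom aQ _) Ut.
move=> /(near_preimage (within_cvg_quotient_cvg q)) H.
apply: filterS2 near_dom H => s sD [+ _ _].
by rewrite (TB_chartK aQ).
Qed.

End Curves.

(** * The Routhian calculus in a chart *)

Section RouthCalculus.
Context {R : realType} {n : nat}.
Notation EQ := ('rV[R]_(1 + n) * 'rV[R]_(1 + n))%type.
Notation EM := ('rV[R]_n * 'rV[R]_n)%type.
Local Notation etheta := (ebase (lshift n ord0) : 'rV[R]_(1 + n)).

Lemma ebase_theta : etheta = row_mx (const_mx 1) 0.
Proof.
apply/rowP => k; rewrite /ebase !mxE eqxx /=.
case: fintype.splitP => l kl; rewrite !mxE; first last.
  by rewrite -val_eqE /= kl.
by rewrite -val_eqE /= kl ord1.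
Qed.

Lemma ebase_rshift (k : 'I_n) :
  ebase (rshift 1 k) = row_mx 0 (ebase k) :> 'rV[R]_(1 + n).
Proof.
apply/rowP => j; rewrite /ebase !mxE eqxx /=.
case: fintype.splitP => l jl; rewrite !mxE ?eqxx /=; last first.
  by rewrite -!val_eqE /= jl.
by rewrite -val_eqE /= jl ord1.
Qed.

(** Compares any two points of [O] that differ in their angle only, whether or
    not the segment between them lies in [O]. *)
Definition theta_invariant (O : set EQ) (g : EQ -> R) : Prop :=
  forall y y', O y -> O y' -> rsubmx y.1 = rsubmx y'.1 -> y.2 = y'.2 ->
    g y = g y'.

Lemma theta_invariant_derive (O : set EQ) (g : EQ -> R) (v : EQ) :
  open O -> theta_invariant O g -> theta_invariant O ('D_v g).
Proof.
move=> Oo gO y y' Oy Oy' y1 y2.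
have yE : y + (y' - y) = y' by rewrite addrC subrK.
have -> : 'D_v g y' = 'D_v (g \o shift (y' - y)) y.
  have E : (fun h : R => h^-1 *: ((g \o shift y') (h *: v) - g y')) =
    (fun h => h^-1 *: (((g \o shift (y' - y)) \o shift y) (h *: v)
                       - (g \o shift (y' - y)) y)).
    by apply/funext => h /=; rewrite -(addrA (h *: v)) yE.
  by rewrite /derive E.
apply: near_eq_derive.
have F : shift (y' - y) @ y --> y + (y' - y).
  exact: (cvgD cvg_id (cvg_cst _)).
rewrite yE in F.
have Oy0 := open_nbhs_nbhs (conj Oo Oy).
have Oy'0 := near_preimage F (open_nbhs_nbhs (conj Oo Oy')).
apply: filterS2 Oy0 Oy'0 => x Ox Ox'; apply: gO => //=.
  by rewrite !linearD linearN /= y1 subrr addr0.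
by rewrite y2 subrr addr0.
Qed.

Lemma derive_theta0 (O : set EQ) (g : EQ -> R) (y : EQ) :
  open O -> theta_invariant O g -> O y -> 'D_(etheta, 0) g y = 0.
Proof.
move=> Oo gO Oy.
rewrite (@near_eq_derive_line _ _ _ _ (cst (g y)) _ _ 0) ?derive_cst//.
have F : (fun h : R => h *: (etheta, 0) + y : EQ) @ (0 : R) --> y.
  rewrite -[X in _ --> X]add0r -(scale0r ((etheta, 0) : EQ)).
  apply: cvgD; last exact: cvg_cst.
  by apply: cvgZ; [exact: cvg_id|exact: cvg_cst].
apply: filterS (near_preimage F (open_nbhs_nbhs (conj Oo Oy))) => h Oh.
apply: gO => //=; last by rewrite scaler0 add0r.
by rewrite ebase_theta scale_row_mx -[y.1 in LHS]hsubmxK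
  scaler0 add_row_mx row_mxKr add0r.
Qed.

(** Routh's computation. Differentiating [r = f o Phi - mu sigma] in a base
    direction produces [(df/dthetadot - mu) dsigma], which vanishes on the
    image of [Phi]; hence the first derivatives of [r] are those of [f] at
    [Phi], and a second derivative along [b] is one along the image of [b]
    under [dPhi]. The angular component [c] of [B] is free because [f] does not
    see the angle, and the angular momentum [df/dthetadot] is constant on the
    image of [Phi]. *)
Lemma routh_calculus (f : EQ -> R) (r sigma : EM -> R) (O : set EQ)
    (s0 mu : R) (z0 : EM) :
  let Phi := fun z => row_chart s0 z.1 (sigma z) z.2 in
  open O -> Ck_on 2 O f -> theta_invariant O f -> O (Phi z0) ->
  (\forall z \near z0, differentiable sigma z) ->
  (\forall z \near z0, 'D_(0, etheta) f (Phi z) = mu) ->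
  (\forall z \near z0, r z = f (Phi z) - mu * sigma z) ->
  forall (b : EM) (c : R),
    let B := row_chart c b.1 ('d sigma z0 b) b.2 in
    'D_B ('D_(0, etheta) f) (Phi z0) = 0 /\
    forall k, 'D_B ('D_(0, ebase (rshift 1 k)) f) (Phi z0)
                - 'D_(ebase (rshift 1 k), 0) f (Phi z0) =
              'D_b ('D_(0, ebase k) r) z0 - 'D_(ebase k, 0) r z0.
Proof.
move=> Phi Oo [fd f2] fO Oz sd muE rE b c B.
pose dPhi z (h : EM) := row_chart 0 h.1 ('d sigma z h) h.2.
have Phid z : differentiable sigma z -> is_diff z Phi (dPhi z).
  by move=> sz; exact: (row_chart_is_diff (is_diff_cst s0 z) (fst_is_diff z)
    (differentiableP sz) (snd_is_diff z)).
have sd0 := nbhs_singleton sd.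
have Phic : Phi @ z0 --> Phi z0.
  by apply: differentiable_continuous; exact: (ex_diff (is_diff_def:=Phid _ sd0)).
have Onear := near_preimage Phic (open_nbhs_nbhs (conj Oo Oz)).
have dPhiE z h : dPhi z h = row_chart 0 h.1 0 h.2 + 'd sigma z h *: (0, etheta).
  rewrite /dPhi /row_chart; congr pair => /=; rewrite ?scaler0 ?addr0//.
  rewrite ebase_theta scale_row_mx add_row_mx scaler0 addr0.
  by congr row_mx; apply/rowP => k; rewrite !mxE add0r mulr1.
have claim : \forall z \near z0, forall u,
    'D_u r z = 'D_(row_chart 0 u.1 0 u.2) f (Phi z).
  apply: filterS2 (nbhs_interior rE) (filterI sd (filterI muE Onear)).
  move=> z rz [sz [muz Oz']] u.
  have fz := fd _ Oz'; have Pz := Phid _ sz.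
  rewrite (near_eq_derive _ rz).
  have D1 : is_diff z (f \o Phi) ('d f (Phi z) \o dPhi z).
    exact: (@is_diff_comp _ _ _ _ _ _ _ _ _ Pz (differentiableP fz)).
  have D2 : is_diff z (mu \*: sigma) (mu \*: 'd sigma z).
    exact: (@is_diffZ _ _ _ _ _ _ _ (differentiableP sz)).
  have D := @is_diffB _ _ _ _ _ _ _ _ D1 D2.
  rewrite -[fun z => _ - _]/((f \o Phi) - (mu \*: sigma)).
  rewrite deriveE; last exact: (ex_diff (is_diff_def:=D)).
  rewrite (diff_val (is_diff_def:=D)) !fctE /= dPhiE linearD linearZ /=.
  rewrite -!deriveE// muz [_ *: mu]mulrC addrK//.
have DB v : 'D_B ('D_v f) (Phi z0) = 'd ('D_v f) (Phi z0) (dPhi z0 b).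
  have [gd _] := f2 v.
  have -> : B = dPhi z0 b + c *: (etheta, 0).
    rewrite /B /dPhi /row_chart; congr pair => /=; rewrite ?scaler0 ?addr0//.
    rewrite ebase_theta scale_row_mx add_row_mx scaler0 addr0.
    by congr row_mx; apply/rowP => k; rewrite !mxE add0r mulr1.
  rewrite deriveE ?linearD ?linearZ/=; last exact: gd.
  rewrite -[X in _ + _ *: X]deriveE; last exact: gd.
  rewrite (derive_theta0 Oo (theta_invariant_derive v Oo fO))//.
  by rewrite scaler0 addr0.
have DPhi v : 'd ('D_v f) (Phi z0) (dPhi z0 b) = 'D_b ('D_v f \o Phi) z0.
  have [gd _] := f2 v; have Pz := Phid _ sd0.
  have D1 : is_diff z0 ('D_v f \o Phi) ('d ('D_v f) (Phi z0) \o dPhi z0).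
    exact: (@is_diff_comp _ _ _ _ _ _ _ _ _ Pz (differentiableP (gd _ Oz))).
  rewrite deriveE; last exact: (ex_diff (is_diff_def:=D1)).
  by rewrite (diff_val (is_diff_def:=D1)).
split.
  rewrite DB DPhi (@near_eq_derive _ _ _ _ (cst mu)); last exact: muE.
  by rewrite derive_cst.
move=> k.
have row0E (u v : 'rV[R]_n) : row_chart 0 u 0 v = (row_mx 0 u, row_mx 0 v) by [].
have rowE : row_mx 0 (ebase k) = ebase (rshift 1 k) :> 'rV[R]_(1 + n).
  by rewrite ebase_rshift.
have c1 : 'D_b ('D_(0, ebase (rshift 1 k)) f \o Phi) z0 =
    'D_b ('D_(0, ebase k) r) z0.
  apply: near_eq_derive; apply: filterS claim => z ->.
  by rewrite row0E row_mx0 rowE.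
have c2 : 'D_(ebase k, 0) r z0 = 'D_(ebase (rshift 1 k), 0) f (Phi z0).
  rewrite (nbhs_singleton claim).
  by rewrite row0E row_mx0 rowE.
by rewrite DB DPhi c1 c2.
Qed.

End RouthCalculus.

Section ImplicitFunction.
Context {R : realType}.

(** For each [z] the injective continuous function [m ^~ z] is strictly
    monotone, so [mu] lies strictly between its values at [a y - d] and [a y +
    d] for [z = y]; this persists for [z] near [y], where the intermediate
    value theorem puts the unique solution [a z] between them. The bound [e0]
    on [s] is the size of the chart in which [m s] is known to be continuous.
    *)
Lemma implicit_continuous (V : normedModType R) (m : R -> V -> R) (a : V -> R)
    (mu e0 : R) (y : V) :
  0 < e0 ->
  (forall z, continuous (m ^~ z)) -> (forall z, injective (m ^~ z)) ->
  (forall z, m (a z) z = mu) ->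
  (forall s, `|s - a y| < e0 -> {for y, continuous (m s)}) ->
  {for y, continuous a}.
Proof.
move=> e00 mc mi ma my; apply/cvgrPdist_lt => e e_gt0.
pose d := Num.min (e0 / 2) (e / 2).
have d0 : 0 < d by rewrite lt_min !divr_gt0.
have de0 : d < e0.
  by rewrite gt_min; apply/orP; left; rewrite ltr_pdivrMr// ltr_pMr// ltr1n.
have de : d < e.
  by rewrite gt_min; apply/orP; right; rewrite ltr_pdivrMr// ltr_pMr// ltr1n.
have c1 : {for y, continuous (m (a y - d))}.
  by apply: my; rewrite addrAC subrr add0r normrN gtr0_norm.
have c2 : {for y, continuous (m (a y + d))}.
  by apply: my; rewrite addrAC subrr add0r gtr0_norm.
have lt1 : a y - d < a y by rewrite gtrBl.
have lt2 : a y < a y + d by rewrite ltrDl.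
have conclude z : Num.min (m (a y - d) z) (m (a y + d) z) <= mu
    <= Num.max (m (a y - d) z) (m (a y + d) z) -> `|a y - a z| < e.
  move=> zE; have [||s] := @IVT R (m ^~ z) (a y - d) (a y + d) mu _ _ zE.
  - by rewrite ltW// (lt_trans lt1).
  - by apply: continuous_subspaceT => x; exact: mc.
  rewrite in_itv/= -[mu in _ = mu](ma z) => /andP[s1 s2] /mi <-.
  by apply: le_lt_trans de; rewrite ler_norml; apply/andP; split; lra.
have [mono|mono] : (forall s t, s < t -> m s y < m t y) \/
    (forall s t, s < t -> m t y < m s y).
  have cR : {within [set` (`]-oo, +oo[ : interval R)], continuous (m ^~ y)}.
    by apply: continuous_subspaceT => x; exact: mc.
  have := @itv_continuous_inj_mono R (m ^~ y) `]-oo, +oo[ cR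
    (fun s t _ _ => @mi y s t).
  by move=> [H|H]; [left|right] => s t st; apply: H; rewrite ?in_itv.
- have h1 : \forall z \near y, m (a y - d) z < mu.
    by apply: (cvgr_lt _ c1); rewrite -(ma y); exact: mono.
  have h2 : \forall z \near y, mu < m (a y + d) z.
    by apply: (cvgr_gt _ c2); rewrite -(ma y); exact: mono.
  apply: filterS2 h1 h2 => z h1 h2; apply: conclude.
  by rewrite ge_min le_max (ltW h1) (ltW h2) orbT.
- have h1 : \forall z \near y, mu < m (a y - d) z.
    by apply: (cvgr_gt _ c1); rewrite -(ma y); exact: mono.
  have h2 : \forall z \near y, m (a y + d) z < mu.
    by apply: (cvgr_lt _ c2); rewrite -(ma y); exact: mono.
  apply: filterS2 h1 h2 => z h1 h2; apply: conclude.
  by rewrite ge_min le_max (ltW h1) (ltW h2) orbT.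
Qed.

End ImplicitFunction.

(** * Nondegeneracy of a hyperregular Lagrangian *)

Section Regularity.
Context {R : realType}.

Lemma smooth_line_diff (f : line -> line) : smooth_map (f : @line R -> @line R) ->
  forall p : R, differentiable (f : R -> R) p.
Proof.
move=> fs p; have [U [Uo Up _ _ /(_ 1%N)[+ _]]] := fs p.
by apply; exists p.
Qed.

(** Smoothness of [L] is given in the preferred chart of each point only, hence
    the choice of the chart at [w]. *)
Lemma smooth_chart (E : normedModType R) (N : mfd E) (aN : C1_atlas N)
    (L : TB N -> R) (w : TB N) : smooth_map (L : TB N -> line) ->
  let i : idx (TB N) := at_ w in
  exists O : set (E * E), [/\ open O, O (coord i w),
    forall y, O y -> dom i (param i y) /\ coord i (param i y) = y &
    Ck_on 2 O (L \o param i)].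
Proof.
move=> Ls i; have [U [Uo Uw Ud _ /(_ 2%N)Ls2]] := Ls w.
exists (coord i @` U); split.
- have := Uo i; suff -> : U `&` dom i = U by [].
  by apply/seteqP; split=> [x []//|x Ux]; split=> //; exact: Ud.
- by exists w.
- move=> _ [u Uu <-]; rewrite (TB_chartK aN); last exact: Ud.
  by split=> //; exact: Ud.
- exact: Ls2.
Qed.

(** Moving in one fibre never leaves the preferred chart of the base point, in
    which components are the stored ones. *)
Lemma fibre_derivativeE (n : nat) (N : mfd 'rV[R]_n) (aN : C1_atlas N)
    (L : TB N -> R) (p : N) (v : 'rV[R]_n) k :
  fibre_derivative L (p, v) 0 k =
  'D_(0, ebase k) (L \o param (at_ p : idx (TB N))) (coord (at_ p) p, v).
Proof.
have LE u : (L \o param (at_ p : idx (TB N))) (coord (at_ p) p, u) = L (p, u).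
  have := TB_chartK aN (at_dom aN p : dom (at_ p : idx (TB N)) (p, u)).
  by rewrite /= vcomp_at// => ->.
have sE h : h *: (0, ebase k) + (coord (at_ p) p, v) =
  (coord (at_ p) p, h *: ebase k + v) :> 'rV[R]_n * 'rV[R]_n.
  by congr pair; rewrite /= scaler0 add0r.
pose phi h := L (p, h *: ebase k + v).
have H1 : \forall h \near (0 : R), L (p, h *: ebase k + v) = phi (h + 0).
  by apply: (@nearW _ (nbhs (0 : R))) => h; rewrite /phi addr0.
have H2 : \forall h \near (0 : R),
    (L \o param (at_ p : idx (TB N))) (h *: (0, ebase k) + (coord (at_ p) p, v))
      = phi (h + 0).
  by apply: (@nearW _ (nbhs (0 : R))) => h; rewrite /phi addr0 sE LE.
rewrite /fibre_derivative mxE (near_eq_derive_line H2).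
exact: near_eq_derive_line H1.
Qed.

(** On the fibre over [p] the Legendre map [la] has the inverse [ps], which is
    differentiable as a restriction of the inverse of the Legendre
    transformation. If the second fibre derivatives vanish in direction [d],
    then [la] has zero velocity along [v + h d], so its composite with [ps],
    which is [v + h d] itself, has zero velocity too. *)
Lemma hyperregular_nondegenerate (n : nat) (N : mfd 'rV[R]_n) (aN : C1_atlas N)
    (L : TB N -> R) (p : N) (v d : 'rV[R]_n) :
  smooth_map (L : TB N -> line) -> hyperregular L ->
  (forall k, 'd ('D_(0, ebase k) (L \o param (at_ p : idx (TB N))))
               (coord (at_ p) p, v) (0, d) = 0) ->
  d = 0.
Proof.
move=> Ls [_ [g [gs legK gK]]] H.
have [V [Vo Vv _ [_ f2]]] := smooth_chart aN (p, v) Ls.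
have {}Vv : V (coord (at_ p) p, v) by rewrite /= vcomp_at in Vv.
pose la (u : 'rV[R]_n) : 'rV[R]_n := fibre_derivative L (p, u).
pose ps (a : 'rV[R]_n) : 'rV[R]_n := (g (p, a)).2.
have gE u : g (p, la u) = (p, u) := legK (p, u).
pose phi (h : R) := la (h *: d + v).
have phid k : is_diff (0 : R) (fun h => phi h 0 k) (fun=> 0).
  pose sl (h : R) := (coord (at_ p) p, h *: d + v).
  have sld : is_diff (0 : R) sl (fun h => (0, h *: d)).
    exact: (is_diff_pair (is_diff_cst (coord (at_ p) p) _) (line_is_diff d v 0)).
  have -> : (fun h => phi h 0 k) =
      'D_(0, ebase k) (L \o param (at_ p : idx (TB N))) \o sl.
    by apply/funext => h; rewrite /phi /la fibre_derivativeE.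
  have sl0 : sl 0 = (coord (at_ p) p, v) by rewrite /sl scale0r add0r.
  have [D1 _] := f2 (0, ebase k).
  have {}D1 : is_diff (sl 0) ('D_(0, ebase k) (L \o param (at_ p : idx (TB N))))
    ('d ('D_(0, ebase k) (L \o param (at_ p : idx (TB N)))) (sl 0)).
    by apply: differentiableP; apply: D1; rewrite sl0.
  have -> : (fun=> 0) = 'd ('D_(0, ebase k) (L \o param (at_ p : idx (TB N))))
      (sl 0) \o (fun h : R => (0, h *: d)).
    apply/funext => h /=; rewrite sl0.
    have -> : (0, h *: d) = h *: (0, d) :> 'rV[R]_n * 'rV[R]_n.
      by congr pair; rewrite scaler0.
    by rewrite linearZ /= H scaler0.
  exact: (is_diff_comp sld D1).
have phiD : derivable phi 0 1.
  apply/derivable_mxP => i k; rewrite ord1; apply: diff_derivable.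
  exact: (ex_diff (is_diff_def:=phid k)).
have phi0 : 'd phi 0 1 = 0.
  rewrite -deriveE; last exact/derivable1_diffP.
  rewrite derive_mx//; apply/matrixP => i k; rewrite !mxE ord1.
  rewrite deriveE; last exact: (ex_diff (is_diff_def:=phid k)).
  by rewrite (diff_val (is_diff_def:=phid k)).
have psd : differentiable ps (phi 0).
  have -> : phi 0 = la v by rewrite /phi scale0r add0r.
  have [U [Uo Up Ud _ /(_ 1%N)[gd _]]] := gs (p, la v).
  pose i : idx (CTB N) := at_ p.
  have paramE a : param i (coord (at_ p) p, a) = (p, a).
    rewrite /= (chartK aN (at_dom aN p)); congr pair; apply/rowP => k.
    rewrite mxE (bigD1 k)//= big1 ?addr0.
      by rewrite vcomp_at// /ebase mxE !eqxx mulr1.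
    by move=> j jk; rewrite vcomp_at// /ebase mxE eqxx (negbTE jk) mulr0.
  have coordE a : coord i (p, a) = (coord (at_ p) p, a).
    by congr pair; exact: covcomp_at.
  have := gd (coord i (p, la v)) (ex_intro2 _ _ _ Up erefl).
  rewrite coordE => D.
  have -> : ps = snd \o ((coord (at_ (g (p, la v))) \o g \o param i) \o
      (fun a : 'rV[R]_n => (coord (at_ p) p, a))).
    apply/funext => a; rewrite /comp paramE gE /ps.
    have := gK (p, a); case: (g (p, a)) => q u /(congr1 fst) /= ->.
    by rewrite vcomp_at.
  have D2 : is_diff (la v) (fun a : 'rV[R]_n => (coord (at_ p) p, a))
      (fun h => (0, h)).
    exact: (is_diff_pair (is_diff_cst (coord (at_ p) p) _) (is_diff_id _)).
  apply: differentiable_comp; last exact: (ex_diff (is_diff_def:=snd_is_diff _)).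
  by apply: differentiable_comp => //; exact: (ex_diff (is_diff_def:=D2)).
have E : ps \o phi = fun h => h *: d + v.
  by apply/funext => h; rewrite /= /ps /phi gE.
have dl : 'd (fun h : R => h *: d + v) 0 1 = d.
  have := @diff_val _ _ _ _ _ _ _ (line_is_diff d v 0).
  by move=> /(congr1 (fun f => f 1)) /= ->; rewrite scale1r.
have := diff_comp (proj1 (derivable1_diffP _ _) phiD) psd.
move=> /(congr1 (fun f => f 1)); rewrite E dl => ->.
by rewrite /comp phi0 linear0.
Qed.

End Regularity.

(** * The angular velocity at fixed momentum *)

Section Reduction.
Context {R : realType} {n : nat} {M : mfd 'rV[R]_n} (aM : C1_atlas M).
Notation Q := (Qmfd M).
Notation EQ := ('rV[R]_(1 + n) * 'rV[R]_(1 + n))%type.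
Notation EM := ('rV[R]_n * 'rV[R]_n)%type.
Notation aQ := (Q_C1_atlas aM).
Local Notation etheta := (ebase (lshift n ord0) : 'rV[R]_(1 + n)).
Context (L : TB Q -> R).

Lemma row_chart_shift (h s a : R) (x v : 'rV[R]_n) :
  h *: (0, etheta) + row_chart s x a v = row_chart s x (h + a) v.
Proof.
rewrite /row_chart; congr pair; rewrite /= ?scaler0 ?add0r//.
rewrite ebase_theta scale_row_mx add_row_mx scaler0 add0r.
by congr row_mx; apply/rowP => k; rewrite !mxE mulr1.
Qed.

(** The angular velocity is a chart-independent coordinate, so the momentum is
    an ordinary derivative in it. *)
Lemma momentum_TQpt z a (w : TB M) :
  momentum L (TQpt z a w) = 'D_1 (fun s => L (TQpt z s w)) a.
Proof.
rewrite /momentum /fibre_derivative mxE.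
apply: near_eq_derive_line; apply: (@nearW _ (nbhs (0 : R))) => h.
rewrite /TQpt /= ebase_theta scale_row_mx add_row_mx scaler0 add0r.
by congr (L (_, row_mx _ _)); apply/rowP => k; rewrite !mxE mulr1.
Qed.

Lemma momentum_cyclic z z' a (w : TB M) : cyclic_theta L ->
  momentum L (TQpt z a w) = momentum L (TQpt z' a w).
Proof.
move=> Lc; rewrite !momentum_TQpt; congr ('D_1 _ a).
by apply/funext => s; exact: Lc.
Qed.

(** The infinitesimal generator of [xi] is [xi] in the angular direction, so
    [G_regular] is about [thetadot |-> J_L]; the inverse being differentiable
    excludes zeros of the derivative. *)
Lemma G_regular_momentum z (w : TB M) : G_regular L ->
  let m := fun a => momentum L (TQpt z a w) in
  [/\ continuous m, injective m, forall mu, exists a, m a = mu &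
      forall a, 'D_1 m a != 0].
Proof.
move=> LG m.
have [fs [g [gs fK gK]]] := LG (TQpt z 0 w).
have mE : (fun xi => momentum L ((TQpt z 0 w).1,
    (TQpt z 0 w).2 + generator xi (TQpt z 0 w).1)) = m.
  apply/funext => xi; rewrite generatorE// /m /TQpt /= add_row_mx addr0.
  have -> // : const_mx 0 + const_mx xi = const_mx xi :> 'rV[R]_1.
  by apply/rowP => k; rewrite !mxE add0r.
rewrite mE in fs fK gK.
have md := smooth_line_diff fs; have gd := smooth_line_diff gs.
split.
- by move=> a; exact: differentiable_continuous.
- exact: can_inj fK.
- by move=> mu; exists (g mu); exact: gK.
- by move=> a; exact: (derive_cancel_neq0 (md a) (gd (m a)) fK).
Qed.

Context (L_cyclic : cyclic_theta L) (L_G_regular : G_regular L) (mu : R).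
Local Notation sigma := (thetadot_mu L mu).

Lemma thetadot_muP z w : momentum L (TQpt z (sigma w) w) = mu.
Proof.
rewrite (@momentum_cyclic _ (cexp 0))//.
have [_ _ /(_ mu) H _] := G_regular_momentum (cexp 0) w L_G_regular.
exact: (@xgetPex _ 0 [set a | momentum L (TQpt (cexp 0) a w) = mu] H).
Qed.

Lemma thetadot_mu_uniq z a w : momentum L (TQpt z a w) = mu -> a = sigma w.
Proof.
have [_ inj _ _] := G_regular_momentum z w L_G_regular.
by move=> aE; apply: inj; rewrite thetadot_muP.
Qed.

Lemma momentum_eta w : momentum L w = mu ->
  w = TQpt w.1.1 (sigma (piM w)) (piM w).
Proof.
move=> wmu; rewrite [LHS]TQpt_eta; congr TQpt.
by apply: (@thetadot_mu_uniq w.1.1); rewrite -TQpt_eta.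
Qed.

(** Here [f] is [L] in a chart [i] of S^1 x M, on an open set [O] of valid
    coordinates. *)
Section Chart.
Context (i : idx Q) (O : set EQ).
Let f := L \o param (i : idx (TB Q)).
Context (O_open : open O).
Context (O_chart : forall y, O y ->
  dom i (param (i : idx (TB Q)) y).1 /\
  coord (i : idx (TB Q)) (param (i : idx (TB Q)) y) = y).
Context (f2 : Ck_on 2 O f).

Lemma chart_LE s x a v : O (row_chart s x a v) ->
  f (row_chart s x a v) =
    L (TQpt (cexp 0) a (param (i.2 : idx (TB M)) (x, v))).
Proof.
move=> /O_chart; rewrite /f /comp; set w := param _ _ => -[iw].
move=> wE; rewrite [w]TQpt_eta (L_cyclic _ (cexp 0)).
congr (L (TQpt _ _ _)).
  move: wE; rewrite coord_TQ// => /(congr1 (fun y : EQ => y.2 0 (lshift n ord0))) /=.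
  by rewrite !row_mxEl mxE => ->; rewrite mxE.
rewrite -(TB_chartK aM (i := i.2) (w := piM w)); last by case: iw.
by congr param; rewrite coord_piM// wE /proj_piM /row_chart /= !row_mxKr.
Qed.

Lemma chart_theta_invariant : theta_invariant O f.
Proof.
have rE (y : EQ) : y = row_chart (y.1 0 (lshift n ord0)) (rsubmx y.1)
    (y.2 0 (lshift n ord0)) (rsubmx y.2).
  case: y => u v; rewrite /row_chart; congr pair => /=;
    rewrite -[LHS]hsubmxK; congr row_mx;
    by apply/rowP => k; rewrite !mxE ord1; congr (_ _ (lshift _ _)); apply: val_inj.
move=> y y' Oy Oy' E1 E2; rewrite (rE y) (rE y').
by rewrite !chart_LE -?rE// E1 E2.
Qed.

Lemma near_chart_row s x a v : O (row_chart s x a v) ->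
  \forall b \near a, O (row_chart s x b v).
Proof.
move=> Oa.
have D := row_chart_is_diff (is_diff_cst s a) (is_diff_cst x a) (is_diff_id a)
  (is_diff_cst v a).
have c := differentiable_continuous (ex_diff (is_diff_def:=D)).
exact: (near_preimage c (open_nbhs_nbhs (conj O_open Oa))).
Qed.

Lemma chart_momentum z s x a v : O (row_chart s x a v) ->
  'D_(0, etheta) f (row_chart s x a v) =
    momentum L (TQpt z a (param (i.2 : idx (TB M)) (x, v))).
Proof.
move=> Oa; rewrite momentum_TQpt; apply: near_eq_derive_line.
have F : (fun h : R => h + a) @ (0 : R) --> a.
  have : (fun h : R => h + a) @ (0 : R) --> 0 + a.
    exact: (cvgD (@cvg_id _ (nbhs (0 : R))) (cvg_cst a)).
  by rewrite add0r.
apply: filterS (near_preimage F (near_chart_row Oa)) => h Oh.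
by rewrite row_chart_shift chart_LE//; exact: L_cyclic.
Qed.

Let sigma_ := sigma \o param (i.2 : idx (TB M)).

(** The implicit equation is [df/dthetadot = mu] in the chart of [L]. Its left
    side agrees with the momentum only on [O], whereas monotonicity in the
    scalar variable is a statement on the whole line; so continuity is proved
    with the momentum [m] itself, and differentiability with [df/dthetadot]. *)
Lemma thetadot_mu_diff s z : O (row_chart s z.1 (sigma_ z) z.2) ->
  differentiable sigma_ z.
Proof.
move=> Oz; case: z Oz => x v Oz.
pose g := 'D_(0, etheta) f.
have [gd _] := f2.2 (0, etheta).
pose m a (y : EM) := momentum L (TQpt (cexp 0) a (param (i.2 : idx (TB M)) y)).
have mE a (y : EM) : O (row_chart s y.1 a y.2) -> g (row_chart s y.1 a y.2) = m a y.
  by case: y => y u Oy; rewrite /g (chart_momentum (cexp 0)).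
have m_reg (y : EM) := G_regular_momentum (cexp 0)
  (param (i.2 : idx (TB M)) y) L_G_regular.
pose row (p : R * EM) := row_chart s p.2.1 p.1 p.2.2.
pose drow (p : R * EM) := row_chart 0 p.2.1 p.1 p.2.2.
have rowd p : is_diff p row drow.
  exact: (row_chart_is_diff (is_diff_cst s p)
    (is_diff_comp (snd_is_diff p) (fst_is_diff p.2)) (fst_is_diff p)
    (is_diff_comp (snd_is_diff p) (snd_is_diff p.2))).
have rowc p : {for p, continuous row}.
  exact: differentiable_continuous (ex_diff (is_diff_def:=rowd p)).
have Gd p : O (row p) -> is_diff p (g \o row) ('d g (row p) \o drow).
  by move=> Op; exact: (is_diff_comp (rowd p) (differentiableP (gd _ Op))).
have sc : {for (x, v), continuous sigma_}.
  have /nbhs_ballP[e /= e0 eO] := near_chart_row Oz.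
  apply: (@implicit_continuous _ _ m sigma_ mu e) => //.
  - by move=> y; have [] := m_reg y.
  - by move=> y; have [] := m_reg y.
  - by move=> y; rewrite /m /sigma_ thetadot_muP.
  - move=> a ae.
    have Oa : O (row (a, (x, v))) by apply: eO; rewrite /ball /= distrC.
    have pc : {for (x, v), continuous (fun y : EM => (a, y))}.
      exact: differentiable_continuous (ex_diff
        (is_diff_def:=is_diff_pair (is_diff_cst a (x, v)) (is_diff_id (x, v)))).
    have gc : {for (x, v), continuous ((g \o row) \o (fun y : EM => (a, y)))}.
      apply: continuous_comp => //.
      exact: differentiable_continuous (ex_diff (is_diff_def:=Gd _ Oa)).
    have On := near_preimage pc (near_preimage (rowc _)
    (open_nbhs_nbhs (conj O_open Oa))).
    have E0 : m a (x, v) = g (row (a, (x, v))) by rewrite [RHS]mE.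
    suff : m a @ (x, v) --> g (row (a, (x, v))) by rewrite -E0.
    apply: cvg_trans gc; apply: near_eq_cvg.
    by apply: filterS On => y Oy; rewrite /= -mE.
have Op : O (row (sigma_ (x, v), (x, v))) by [].
apply: (@implicit_differentiable _ _ (g \o row) sigma_ mu) => //.
- exact: (ex_diff (is_diff_def:=Gd _ Op)).
- have [_ _ _ /(_ (sigma_ (x, v)))] := m_reg (x, v).
  rewrite (diff_val (is_diff_def:=Gd _ Op)) /comp.
  have -> : drow (1, 0) = (0, etheta).
    by rewrite /drow /row_chart ebase_theta /= ; congr pair; rewrite row_mx0.
  rewrite -deriveE; last exact: gd.
  rewrite -(@near_eq_derive_line _ _ _ g _ (row (sigma_ (x, v), (x, v))) (0, etheta))//.
  have F : (fun h : R => h + sigma_ (x, v)) @ (0 : R) --> sigma_ (x, v).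
    have : (fun h : R => h + sigma_ (x, v)) @ (0 : R) --> 0 + sigma_ (x, v).
      exact: (cvgD (@cvg_id _ (nbhs (0 : R))) (cvg_cst _)).
    by rewrite add0r.
  apply: filterS (near_preimage F (near_chart_row Oz)) => h Oh.
  by rewrite /row row_chart_shift mE.
- have pc : {for (x, v), continuous (fun y : EM => (sigma_ y, y))}.
    exact: (@cvg_pair _ _ _ _ _ _ _ _ _ sigma_ id sc cvg_id).
  have On := near_preimage pc (near_preimage (rowc _)
    (open_nbhs_nbhs (conj O_open Op))).
  apply: filterS On => y Oy.
  by rewrite /comp mE// /m /sigma_ thetadot_muP.
Qed.

End Chart.
End Reduction.

(** * The forced field on a momentum level *)

Section ReducedField.
Context {R : realType} {n : nat} {M : mfd 'rV[R]_n} (aM : C1_atlas M).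
Notation Q := (Qmfd M).
Notation EQ := ('rV[R]_(1 + n) * 'rV[R]_(1 + n))%type.
Notation EM := ('rV[R]_n * 'rV[R]_n)%type.
Notation aQ := (Q_C1_atlas aM).
Local Notation etheta := (ebase (lshift n ord0) : 'rV[R]_(1 + n)).
Context (L : TB Q -> R) (F : TB Q -> CTB Q) (X : TB Q -> EQ).
Context (L_smooth : smooth_map (L : TB Q -> line)).
Context (X_EL : forced_EL_field L F X).
Context (L_hyperregular : hyperregular L) (L_G_regular : G_regular L).
Context (L_cyclic : cyclic_theta L).
Context (F_theta0 : forall w, force_theta F w = 0).
Context (F_x_indep : forall theta theta' a w,
     force_x F (TQpt theta a w) = force_x F (TQpt theta' a w)).
Context (mu : R) (Xmu : TB M -> EM).
Context (Xmu_EL : forced_EL_field (routhian L mu) (reduced_force L F mu) Xmu).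
Local Notation sigma := (thetadot_mu L mu).

Lemma coord_TQpt_at z a (w : TB M) :
  coord (at_ (TQpt z a w)) (TQpt z a w) =
  row_chart (at_ z : R) (coord (at_ w) w).1 a (coord (at_ w) w).2.
Proof.
rewrite coord_TQ//; last exact: at_dom aQ _.
by rewrite [(TQpt z a w).2]/(row_mx (const_mx a) w.2) row_mxKl row_mxKr
  coord_at_circle.
Qed.

(** Any angle serves, since the momentum does not depend on it. *)
Lemma thetadot_mu_at_diff (w : TB M) :
  differentiable (sigma \o param (at_ w)) (coord (at_ w) w).
Proof.
pose w' := TQpt (cexp 0) (sigma w) w.
have [V [Oo Ow Oc f2]] := smooth_chart aQ w' L_smooth.
apply: (thetadot_mu_diff aM L_cyclic L_G_regular Oo Oc f2
  (s := at_ (cexp 0 : circle R) : R)).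
rewrite /comp (TB_chartK aM (i := at_ w)); last exact: at_dom aM _.
by rewrite -coord_TQpt_at.
Qed.

Lemma forced_EL_at (m : nat) (N : mfd 'rV[R]_m) (aN : C1_atlas N) (l : TB N -> R)
    (G : TB N -> CTB N) (Y : TB N -> 'rV[R]_m * 'rV[R]_m) (w : TB N) :
  forced_EL_field l G Y ->
  let y := coord (at_ w) w in
  (Y w).1 = y.2 /\
  forall k, 'D_(Y w) ('D_(0, ebase k) (l \o param (at_ w : idx (TB N)))) y
    - 'D_(ebase k, 0) (l \o param (at_ w : idx (TB N))) y = (G w).2 0 k.
Proof.
move=> [_ H]; have [H1 H2] := H w (at_ w) (at_dom aN _).
rewrite (TB_vcomp_at aN) in H1 H2; split=> // k.
by rewrite H2 covcomp_at.
Qed.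

(** The pointwise form of Routh reduction, from which both directions of the
    theorem follow. By [routh_calculus] the right side [B] solves the linear
    equations that the forced Euler-Lagrange equations of [L] impose on [X]:
    those in the base directions are the equations of the Routhian, and the
    angular one says that [J_L] stays equal to [mu]. Both vectors are second
    order, so they differ by a fibre direction, which
    [hyperregular_nondegenerate] shows to be zero. *)
Lemma forced_field_lift z (w : TB M) :
  X (TQpt z (sigma w) w) =
  row_chart (sigma w) (Xmu w).1
    ('d (sigma \o param (at_ w)) (coord (at_ w) w) (Xmu w)) (Xmu w).2.
Proof.
pose w' := TQpt z (sigma w) w.
have [V [Oo Ow Oc f2]] := smooth_chart aQ w' L_smooth.
pose i : idx Q := at_ w'.1.
set f := L \o _ in f2.
pose s0 : R := at_ z.
pose z0 := coord (at_ w) w.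
pose sg := sigma \o param (at_ w : idx (TB M)).
pose Phi y := row_chart s0 y.1 (sg y) y.2.
have sg0 : sg z0 = sigma w.
  by rewrite /sg /z0 /comp (TB_chartK aM)//; exact: at_dom aM _.
have PhiE : coord (at_ w') w' = Phi z0 by rewrite coord_TQpt_at /Phi sg0.
have OPhi : V (Phi z0) by rewrite -PhiE.
have sd y : V (Phi y) -> differentiable sg y.
  exact: (thetadot_mu_diff aM L_cyclic L_G_regular Oo Oc f2).
have Phic : Phi @ z0 --> Phi z0.
  have D := row_chart_is_diff (is_diff_cst s0 z0) (fst_is_diff z0)
    (differentiableP (sd _ OPhi)) (snd_is_diff z0).
  exact: differentiable_continuous (ex_diff (is_diff_def:=D)).
have On := near_preimage Phic (open_nbhs_nbhs (conj Oo OPhi)).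
have sdn : \forall y \near z0, differentiable sg y by apply: filterS On.
have mun : \forall y \near z0, 'D_(0, etheta) f (Phi y) = mu.
  apply: filterS On => y Oy.
  rewrite (chart_momentum aM L_cyclic Oo Oc (cexp 0) Oy).
  by case: y Oy => y u Oy; rewrite thetadot_muP.
have rn : \forall y \near z0, (routhian L mu \o param (at_ w : idx (TB M))) y =
    f (Phi y) - mu * sg y.
  apply: filterS On => y Oy; rewrite [f (Phi y)](chart_LE aM L_cyclic Oc Oy).
  by case: y Oy.
have fO := chart_theta_invariant aM L_cyclic Oc.
have [EL1 EL2] := forced_EL_at aQ w' X_EL.
have [r1 r2] := forced_EL_at aM w Xmu_EL.
have [Bth Bx] := routh_calculus Oo f2 fO OPhi sdn mun rn (Xmu w) (sigma w).
pose B := row_chart (sigma w) (Xmu w).1 ('d sg z0 (Xmu w)) (Xmu w).2.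
rewrite -/B in Bth Bx.
rewrite PhiE in EL1 EL2.
have XB k : 'D_(X w') ('D_(0, ebase k) f) (Phi z0) =
    'D_B ('D_(0, ebase k) f) (Phi z0).
  have := EL2 k; rewrite -[k]splitK; case: (fintype.split k) => l /=.
    rewrite (ord1 l) Bth (derive_theta0 Oo fO OPhi) subr0 => E.
    by rewrite [LHS]E; exact: F_theta0.
  move=> E; apply: (addIr (- 'D_(ebase (rshift 1 l), 0) f (Phi z0))).
  refine (etrans E (esym (etrans (Bx l) (etrans (r2 l) _)))).
  have := F_x_indep (cexp 0) z (sigma w) w.
  by move=> /(congr1 (fun v : 'rV[R]_n => v 0 l)); rewrite /force_x !mxE.
have X1 : (X w').1 = B.1.
  by rewrite EL1 /Phi /B /row_chart /= sg0 r1.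
suff X2 : (X w').2 - B.2 = 0.
  rewrite [LHS]surjective_pairing [RHS]surjective_pairing X1.
  by congr pair; apply/eqP; rewrite -subr_eq0; apply/eqP.
apply: (@hyperregular_nondegenerate R (1 + n) Q aQ L w'.1 w'.2 _ L_smooth
  L_hyperregular) => k.
have cE : (coord (at_ w'.1) w'.1, w'.2) = Phi z0.
  rewrite -PhiE; congr pair; rewrite vcomp_at//; exact: aQ.
have D : differentiable ('D_(0, ebase k) f) (Phi z0).
  by have [+ _] := f2.2 (0, ebase k); apply.
rewrite cE -/f.
have -> : (0, (X w').2 - B.2) = X w' - B :> EQ.
  by rewrite [X w' in RHS]surjective_pairing X1; congr pair; rewrite /= subrr.
by rewrite linearB /= -!deriveE// XB subrr.
Qed.

End ReducedField.

(** * Reconstruction of the angle *)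

Section Primitive.
Context {R : realType}.

(** The fundamental theorem of calculus gives two-sided derivatives at interior
    points of continuity. Precomposing with a retraction [r] onto [I] extends
    [g] continuously to an open set [O], where the integral has a derivative at
    the end points of [I] as well. *)
Lemma primitive_retract (I O : set R) (r g : R -> R) (a : R) :
  open O -> (forall s t, O t -> s <= t -> O s) -> I `<=` O ->
  continuous r -> (forall s, O s -> I (r s)) -> (forall s, I s -> r s = s) ->
  (forall t, I t -> g @ within I (nbhs t) --> g t) ->
  exists P : R -> R, P a = 0 /\ forall t, I t -> a <= t ->
    (fun s => (s - t)^-1 *: (P s - P t)) @ within (I `\ t) (nbhs t) --> g t.
Proof.
move=> Oo Od IO rc rI rid gc.
have gr_cont s : O s -> {for s, continuous (g \o r)}.
  move=> Os; have Ir := rI _ Os.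
  suff H : r @ s --> within I (nbhs (r s)).
    by exact: (@cvg_comp _ _ _ r g _ _ _ H (gc _ Ir)).
  move=> U /(rc s) /= H; rewrite nbhs_filterE in H.
  have On := open_nbhs_nbhs (conj Oo Os).
  have {}H : \forall x \near s, I (r x) -> U (r x) by [].
  suff : \forall x \near s, U (r x) by [].
  by apply: filterS2 H On => x Ux Ox; exact: (Ux (rI _ Ox)).
(* Integrating from [a - 1] puts [a] in the interior of the domain. *)
pose P0 x := (\int[lebesgue_measure]_(t in [set` `[a - 1, x]]) (g \o r) t)%R.
exists (fun x => P0 x - P0 a); split; first by rewrite subrr.
move=> t It at_; have Ot := IO _ It.
have /nbhs_ballP[e /= e0 eO] := open_nbhs_nbhs (conj Oo Ot).
pose u := t + e / 2.
have tu : t < u by rewrite ltrDl divr_gt0.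
have Ou : O u.
  apply: eO; rewrite /ball /= /u opprD addNKr normrN gtr0_norm ?divr_gt0//.
  by rewrite ltr_pdivrMr// ltr_pMr// ltr1n.
have int : lebesgue_measure.-integrable `[a - 1, u] (EFin \o (g \o r)).
  apply: continuous_compact_integrable; first exact: segment_compact.
  apply: continuous_in_subspaceT => x; rewrite inE/= in_itv/= => /andP[_ xu].
  exact: gr_cont (Od _ _ Ou xu).
have a1t : a - 1 < t by rewrite (lt_le_trans _ at_)// ltrBlDr ltrDl.
have [Pd PE] := continuous_FTC1_closed tu int a1t (gr_cont _ Ot).
rewrite -/P0 in Pd PE.
have {}Pd : differentiable P0 t by exact/derivable1_diffP.
(* The one-sided quotients follow from the chain rule along the curve [id]. *)
have q1 : (fun s => (s - t)^-1 *: (s - t)) @ within (I `\ t) (nbhs t) --> (1 : R).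
  apply: (@cvg_trans _ (cst 1 @ within (I `\ t) (nbhs t))); last exact: cvg_cst.
  apply: near_eq_cvg; rewrite near_withinE; apply: nearW => s [_ /eqP st].
  by rewrite /= /GRing.scale /= mulVf// subr_eq0.
have := @within_cvg_quotient_diff _ _ _ P0 id I t 1 Pd q1.
rewrite -deriveE// -derive1E PE /= rid//.
apply: cvg_trans; apply: near_eq_cvg; apply: nearW => s /=.
by rewrite opprB addrA subrK.
Qed.

(** The three shapes of intervals of a hybrid flow. The retraction clamps to
    [[a, b]], respectively at [a] only; for [[a, b[] the extension is
    continuous on []-oo, b[] only, which still contains [[a - 1, u]] for every
    [u < b]. *)
Lemma primitive_exists (I : set R) (g : R -> R) (a b : R) :
  (a <= b /\ (I = `[a, b]%classic \/ I = `[a, b[%classic))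
    \/ I = `[a, +oo[%classic ->
  (forall t, I t -> g @ within I (nbhs t) --> g t) ->
  exists P : R -> R, P a = 0 /\ forall t, I t ->
    (fun s => (s - t)^-1 *: (P s - P t)) @ within (I `\ t) (nbhs t) --> g t.
Proof.
move=> IE gc.
have maxc : continuous (fun s : R => Num.max a s).
  by move=> s; apply: continuous_max; [exact: cst_continuous|exact: cvg_id].
have aI t : I t -> a <= t.
  by case: IE => [[_ [] ->]|->]; rewrite /= in_itv/= => /andP[].
suff [P [Pa HP]] : exists P : R -> R, P a = 0 /\ forall t, I t -> a <= t ->
    (fun s => (s - t)^-1 *: (P s - P t)) @ within (I `\ t) (nbhs t) --> g t.
  by exists P; split=> // t It; apply: HP => //; exact: aI.
case: IE aI gc => [[ab [] ->]|->] aI gc.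
- apply: (@primitive_retract _ setT (fun s => Num.max a (Num.min b s))) => //.
  + exact: openT.
  + move=> s; apply: (@continuous_comp _ _ _ (fun s : R => Num.min b s)
      (fun s => Num.max a s)).
      by apply: continuous_min; [exact: cst_continuous|exact: cvg_id].
    exact: maxc.
  + by move=> s _; rewrite /= in_itv/= le_max lexx/= ge_max ab ge_min lexx.
  + move=> s /=; rewrite in_itv/= => /andP[sa sb].
    by rewrite (min_idPr sb) (max_idPr sa).
- have [ab'|ba] := ltP a b; last first.
    exists (fun=> 0); split=> // t /=; rewrite in_itv/= => /andP[at_ tb].
    by have := le_lt_trans at_ tb; rewrite ltNge ba.
  apply: (@primitive_retract _ `]-oo, b[%classic (fun s => Num.max a s)) => //.
  + by move=> s t /=; rewrite !in_itv/= => tb /le_lt_trans; apply.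
  + by move=> t /=; rewrite !in_itv/= => /andP[].
  + by move=> s /=; rewrite !in_itv/= le_max lexx/= gt_max ab'.
  + by move=> s /=; rewrite in_itv/= => /andP[/max_idPr].
- apply: (@primitive_retract _ setT (fun s => Num.max a s)) => //.
  + exact: openT.
  + by move=> s _ /=; rewrite in_itv/= le_max lexx.
  + by move=> s /=; rewrite in_itv/= andbT => /max_idPr.
Qed.

End Primitive.

Section Hybrid.
Context {R : realType} {n : nat} {M : mfd 'rV[R]_n} (aM : C1_atlas M).
Notation Q := (Qmfd M).

Lemma comp_integral_curve_cvg (E : normedModType R) (N : mfd E) (aN : C1_atlas N)
    (X : TB N -> E * E) (I : set R) (c : R -> TB N) (f : TB N -> R) :
  integral_curve X I c ->
  (forall w, differentiable (f \o param (at_ w)) (coord (at_ w) w)) ->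
  forall t, I t -> (f \o c) @ within I (nbhs t) --> f (c t).
Proof.
move=> cX fd t It; have [_ cq] := cX t It.
have cc := within_cvg_quotient_cvg cq.
have fc := differentiable_continuous (fd (c t)).
have fcE w : dom (at_ (c t)) w -> (f \o param (at_ (c t))) (coord (at_ (c t)) w) = f w.
  by move=> wd; rewrite /comp (TB_chartK aN).
have H := @cvg_comp _ _ _ (fun s => coord (at_ (c t)) (c s))
  (f \o param (at_ (c t))) _ _ _ cc fc.
rewrite fcE in H; last exact: at_dom aN _.
apply: cvg_trans H; apply: near_eq_cvg.
by apply: filterS (integral_curve_near_dom aN cX It) => s ds; exact: fcE.
Qed.

Lemma solution_ival (E : normedModType R) (D : mfd E) (X : D -> E) (S : set D)
    (Delta : D -> D) (c : hybrid_arc D) i :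
  solution X S Delta c -> index c i -> exists b,
  (tau c i <= b /\ (ival c i = `[tau c i, b]%classic \/
     ival c i = `[tau c i, b[%classic)) \/ ival c i = `[tau c i, +oo[%classic.
Proof.
move=> sc ci; exists (tau c i.+1).
have [ciS|ciS] := pselect (index c i.+1).
  by have [? ?] := sol_ival sc ci ciS; left; split=> //; left.
have [cE|[m cE]] := sol_index sc; first by case: ciS; rewrite cE.
have -> : i = m; last exact: (sol_last sc cE).
move: ci ciS; rewrite cE /= ltnS => im mi; apply/eqP.
by rewrite eqn_leq im /= leqNgt; apply/negP.
Qed.

Lemma ival_impact_time (E : normedModType R) (D : mfd E) (X : D -> E)
    (S : set D) (Delta : D -> D) (c : hybrid_arc D) i :
  solution X S Delta c -> index c i -> index c i.+1 ->
  ival c i (tau c i.+1).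
Proof.
move=> sc ci ciS; have [le ->] := sol_ival sc ci ciS.
by rewrite /= in_itv/= le lexx.
Qed.

Context (L : TB Q -> R) (S : set (TB Q)) (Delta : TB Q -> TB Q).
Context (L_cyclic : cyclic_theta L) (L_G_regular : G_regular L).
Context (S_hybrid : hybrid_action L S Delta) (mu : R).

(** The switching surface is invariant, and points of momentum [mu] over one
    base point differ by a rotation: over a point of the reduced surface every
    lift of momentum [mu] is on the surface. *)
Lemma surface_TQpt w z : momentum L w = mu -> S w ->
  S (TQpt z (thetadot_mu L mu (piM w)) (piM w)).
Proof.
move=> wmu Sw; have [t1 z1] := cexp_surj w.1.1; have [t2 z2] := cexp_surj z.
have -> : z = cmul (cexp (t2 - t1)) w.1.1.
  by rewrite -z1 -cexpD subrK.
rewrite -tangent_psi_TQpt// -momentum_eta//.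
exact: ha_surface S_hybrid _ _ Sw.
Qed.

End Hybrid.

Theorem mainTheorem2 (R : realType) (n : nat)
  (M : mfd 'rV[R]_n) (M_manifold : smooth_manifold M)
  (L : TB (Qmfd M) -> R) (F : TB (Qmfd M) -> CTB (Qmfd M))
  (X : TB (Qmfd M) -> ('rV[R]_(1 + n) * 'rV[R]_(1 + n))%type)
  (* dim TQ = 2 (n + 1) *)
  (Sig : mfd 'rV[R]_(n + n).+1) (iota : Sig -> TB (Qmfd M))
  (S : set (TB (Qmfd M))) (Delta : TB (Qmfd M) -> TB (Qmfd M))
  (L_smooth : smooth_map (L : TB (Qmfd M) -> line))
  (F_force : external_force F)
  (X_EL : forced_EL_field L F X)
  (LF_hybrid : simple_hybrid_system X iota S Delta)
  (L_hyperregular : hyperregular L)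
  (L_G_regular : G_regular L)
  (L_cyclic : cyclic_theta L)
  (F_theta0 : forall w, force_theta F w = 0)
  (F_x_indep : forall theta theta' a w,
     force_x F (TQpt theta a w) = force_x F (TQpt theta' a w))
  (action_hybrid : hybrid_action L S Delta)
  (elastic : forall w, S w -> momentum L (Delta w) = momentum L w)
  (mu : R) (mu_regular : hybrid_regular_value L iota mu)
  (Xmu : TB M -> ('rV[R]_n * 'rV[R]_n)%type)
  (Xmu_EL : forced_EL_field (routhian L mu) (reduced_force L F mu) Xmu)
  (Delta_mu : TB M -> TB M)
  (Delta_mu_induced : induced_impact L S Delta mu Delta_mu) :
  (forall c : @hybrid_arc R (TB (Qmfd M)),
     solution X S Delta c -> has_momentum L mu c ->
     solution Xmu (reduced_surface L S mu) Delta_mu (map_arc (@piM R n M) c)) /\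
  (forall cbar : @hybrid_arc R (TB M),
     solution Xmu (reduced_surface L S mu) Delta_mu cbar ->
     exists c : @hybrid_arc R (TB (Qmfd M)),
       [/\ solution X S Delta c, has_momentum L mu c &
           is_projection (@piM R n M) c cbar]).
Proof.
have aM := smooth_C1_atlas M_manifold.
have XE := forced_field_lift aM L_smooth X_EL L_hyperregular L_G_regular
  L_cyclic F_theta0 F_x_indep Xmu_EL.
pose sigma := thetadot_mu L mu.
have sd := thetadot_mu_at_diff aM L_smooth L_G_regular L_cyclic mu.
split=> [c sc cmu|cbar sc].
  split=> //=.
  - exact: sol_index sc.
  - exact: sol_ival sc.
  - exact: sol_last sc.
  - move=> i ci; apply: (integral_curve_piM aM _ (sol_curve sc ci)) => t It.
    rewrite [curve c i t](momentum_eta L_cyclic L_G_regular (cmu i t ci It)).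
    rewrite XE piM_TQpt /proj_piM /row_chart !row_mxKr.
    by rewrite -surjective_pairing.
  - move=> i ci ciS; have [Ii Si Di] := sol_impact sc ci ciS.
    have m := cmu i _ ci (ival_impact_time sc ci ciS).
    split=> //; first by exists (curve c i (tau c i.+1)).
    by rewrite Delta_mu_induced// Di.
pose primitive i (p : R -> R) := index cbar i -> p (tau cbar i) = 0 /\
  forall t, ival cbar i t ->
    (fun s => (s - t)^-1 *: (p s - p t))
      @ within (ival cbar i `\ t) (nbhs t) --> sigma (curve cbar i t).
have [P HP] : {P : nat -> R -> R & forall i, primitive i (P i)}.
  apply: (@choice _ _ primitive) => i.
  have [ci|ci] := pselect (index cbar i); last by exists (fun=> 0).
  have [b Ib] := solution_ival sc ci.
  have [p Hp] := primitive_exists Ib (comp_integral_curve_cvg aM (sol_curve sc ci) sd).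
  by exists p.
pose lift z i t := TQpt (cmul z (cexp (P i t))) (sigma (curve cbar i t))
  (curve cbar i t).
(* Each piece starts at the angle to which the impact map sends the end of the
   preceding piece; the first angle is arbitrary. *)
pose angle := fix angle i : circle R := if i is j.+1
  then (Delta (lift (angle j) j (tau cbar i))).1.1 else cexp 0.
pose c := HybridArc (index cbar) (tau cbar) (ival cbar) (fun i => lift (angle i) i).
have cmu : has_momentum L mu c.
  by move=> i t _ _; exact: thetadot_muP.
exists c; split=> //; last by split=> //= i t _ _; exact: piM_TQpt.
split=> /=.
- exact: sol_index sc.
- exact: sol_ival sc.
- exact: sol_last sc.
- move=> i ci.
  apply: (integral_curve_lift aM (sol_curve sc ci) (HP i ci).2).
    by move=> t _; exact: sd.
  by move=> t _; exact: XE.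
- move=> i ci ciS; have [Ii [w [Sw wmu] wE] Di] := sol_impact sc ci ciS.
  have Sl : S (lift (angle i) i (tau cbar i.+1)).
    rewrite /lift -wE.
    exact: (surface_TQpt aM L_cyclic L_G_regular action_hybrid _ wmu Sw).
  split=> //.
  have Dmu : momentum L (Delta (lift (angle i) i (tau cbar i.+1))) = mu.
    by rewrite elastic// thetadot_muP.
  rewrite [LHS](momentum_eta L_cyclic L_G_regular Dmu).
  rewrite -Delta_mu_induced ?thetadot_muP// piM_TQpt Di.
  rewrite [in RHS]/lift (HP _ ciS).1 -/sigma.
  by rewrite cmul_cexp0.
Qed.
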